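(* Let $(H,\circ)$ be a compact quantum group and let $\lozenge:H\to H$ be a conjugate linear involution such that $(H,\lozenge)$ is a $\circ$-Hopf algebra. Then: (1) There exists a Hopf algebra automorphism $P$ of $H$, positive with respect to the inner product associated to $\circ$, such that the involutions $\lozenge$ and $P\circ P^{-1}$ commute with each other. (2) If $(H,\lozenge)$ is also a compact quantum group, then (for this $P$) $\lozenge=P\circ P^{-1}$. Here $P\circ P^{-1}$ denotes the conjugate of the involution $\circ$ by $P$, that is, the map $x\mapsto P\big((P^{-1}(x))^\circ\big)$.
   Context: Everything is over $\mathbb{C}$. A $\circ$-structure on a coalgebra is a conjugate linear involution $c\mapsto c^\circ$ with $\Delta(c^\circ)=\sum c_2^\circ\otimes c_1^\circ$. A $\circ$-Hopf algebra $(H,\circ)$ is a Hopf algebra $H$ with a $\circ$-structure $\circ$ on its underlying coalgebra such that $(xy)^\circ=x^\circ y^\circ$; the same definition, with $\lozenge$ in place of $\circ$, applies to $(H,\lozenge)$. A unitary inner product on a right $H$-comodule $V$ (with coaction $v\mapsto\sum v_0\otimes v_1$) is an inner product (linear in the first, conjugate linear in the second variable) with $\sum\langle u_0,v\rangle u_1=\sum\langle u,v_0\rangle v_1^\circ$ for all $u,v$. A compact quantum group is a $\circ$-Hopf algebra such that every right $H$-comodule admits a unitary inner product. Such an $H$ is cosemisimple; its normal integral $\varphi:H\to\mathbb{C}$ is the projection onto the simple subcoalgebra $\mathbb{C}1\cong\mathbb{C}$ along the sum of the other simple subcoalgebras. The inner product associated to $\circ$ is $\langle x,y\rangle=\varphi(S(y^\circ)x)$,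 $S$ being the antipode. A linear operator $L:H\to H$ is positive if it is selfadjoint for this inner product and $\langle L(x),x\rangle>0$ for all $x\neq0$. *)

(* Defs.v *)
From HB Require Import structures.
From mathcomp Require Import all_boot all_order all_algebra.
From mathcomp Require Import sesquilinear.
From mathcomp Require Import boolp classical_sets reals.
From mathcomp Require Import complex.

Set Implicit Arguments.
Unset Strict Implicit.
Unset Printing Implicit Defensive.

Import Order.TTheory GRing.Theory Num.Theory.

Local Open Scope quotient_scope.
Local Open Scope ring_scope.

(** A finite sequence of pairs stands for the formal sum of the corresponding
    pure tensors.  The tensor product is the quotient of these formal sums by
    the congruence generated by the bilinearity relations; negation is
    available because -(v ⊗ w) = (-v) ⊗ w. *)

Section TensorRelation.
Variables (K : fieldType) (V W : lmodType K).

Inductive tensor_eq : seq (V * W) -> seq (V * W) -> Prop :=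
| Teq_refl s : tensor_eq s s
| Teq_sym s t : tensor_eq s t -> tensor_eq t s
| Teq_trans s t u : tensor_eq s t -> tensor_eq t u -> tensor_eq s u
| Teq_cat s s' t t' :
    tensor_eq s s' -> tensor_eq t t' -> tensor_eq (s ++ t) (s' ++ t')
| Teq_catC s t : tensor_eq (s ++ t) (t ++ s)
| Teq_0 w : tensor_eq [:: (0, w)] [::]
| Teq_Dl v v' w : tensor_eq [:: (v + v', w)] [:: (v, w); (v', w)]
| Teq_Dr v w w' : tensor_eq [:: (v, w + w')] [:: (v, w); (v, w')]
| Teq_Z a v w : tensor_eq [:: (a *: v, w)] [:: (v, a *: w)].

Definition tensor_eqb (s t : seq (V * W)) : bool := `[< tensor_eq s t >].

Fact tensor_eqb_refl : reflexive tensor_eqb.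
Proof. by move=> s; apply/asboolP; exact: Teq_refl. Qed.

Fact tensor_eqb_sym : symmetric tensor_eqb.
Proof. by move=> s t; apply/asboolP/asboolP; exact: Teq_sym. Qed.

Fact tensor_eqb_trans : transitive tensor_eqb.
Proof.
move=> t s u /asboolP st /asboolP tu; apply/asboolP; exact: Teq_trans st tu.
Qed.

Canonical tensor_equiv :=
  EquivRel tensor_eqb tensor_eqb_refl tensor_eqb_sym tensor_eqb_trans.

Definition tensor := {eq_quot tensor_equiv}.
HB.instance Definition _ := Choice.on tensor.
HB.instance Definition _ := EqQuotient.on tensor.

Definition tensor_of (s : seq (V * W)) : tensor := \pi_tensor s.

Lemma tensor_ofP s t : tensor_of s = tensor_of t <-> tensor_eq s t.
Proof.
split=> [/eqP|st]; first by rewrite piE => /asboolP.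
by apply/eqP; rewrite piE; apply/asboolP.
Qed.

Lemma repr_tensor_of s : tensor_eq (repr (tensor_of s)) s.
Proof. by apply/tensor_ofP; rewrite /tensor_of reprK. Qed.

Lemma tensor_of_repr t : tensor_of (repr t) = t.
Proof. by rewrite /tensor_of reprK. Qed.

Definition scale_formal (a : K) (s : seq (V * W)) : seq (V * W) :=
  [seq (a *: p.1, p.2) | p <- s].

Lemma scale_formal_eq a s t :
  tensor_eq s t -> tensor_eq (scale_formal a s) (scale_formal a t).
Proof.
rewrite /scale_formal; elim=> {s t} //=.
- by move=> s; exact: Teq_refl.
- by move=> s t _; exact: Teq_sym.
- by move=> s t u _ st _; exact: Teq_trans.
- by move=> s s' t t' _ ss' _ tt'; rewrite !map_cat; exact: Teq_cat.
- by move=> s t; rewrite !map_cat; exact: Teq_catC.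
- by move=> w; rewrite scaler0; exact: Teq_0.
- by move=> v v' w; rewrite scalerDr; exact: Teq_Dl.
- by move=> v w w'; exact: Teq_Dr.
- by move=> b v w; rewrite scalerA mulrC -scalerA; exact: Teq_Z.
Qed.

Definition tensor_zero : tensor := tensor_of [::].
Definition tensor_add (t u : tensor) : tensor := tensor_of (repr t ++ repr u).
Definition tensor_scale (a : K) (t : tensor) : tensor :=
  tensor_of (scale_formal a (repr t)).
Definition tensor_opp (t : tensor) : tensor := tensor_scale (-1) t.

Lemma tensor_addE s t :
  tensor_add (tensor_of s) (tensor_of t) = tensor_of (s ++ t).
Proof. by apply/tensor_ofP; apply: Teq_cat; exact: repr_tensor_of. Qed.

Lemma tensor_scaleE a s :
  tensor_scale a (tensor_of s) = tensor_of (scale_formal a s).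
Proof. by apply/tensor_ofP/scale_formal_eq; exact: repr_tensor_of. Qed.

Fact tensor_addA : associative tensor_add.
Proof.
move=> x y z.
rewrite -[x]tensor_of_repr -[y]tensor_of_repr -[z]tensor_of_repr.
by rewrite !tensor_addE catA.
Qed.

Fact tensor_addC : commutative tensor_add.
Proof. by move=> x y; apply/tensor_ofP; exact: Teq_catC. Qed.

Fact tensor_add0 : left_id tensor_zero tensor_add.
Proof. by move=> x; rewrite -[x]tensor_of_repr tensor_addE. Qed.

Fact tensor_scaleDl t a b :
  tensor_scale (a + b) t = tensor_add (tensor_scale a t) (tensor_scale b t).
Proof.
rewrite /tensor_scale tensor_addE; apply/tensor_ofP.
elim: (repr t) => [|[v w] s IH] /=; first exact: Teq_refl.
rewrite scalerDl.
apply: Teq_trans (_ : tensor_eq ([:: (a *: v, w); (b *: v, w)] ++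
  (scale_formal a s ++ scale_formal b s)) _).
  by rewrite -cat1s; apply: Teq_cat => //; exact: Teq_Dl.
set x := (a *: v, w); set y := (b *: v, w).
set A := scale_formal a s; set B := scale_formal b s.
have -> : [:: x; y] ++ A ++ B = [:: x] ++ ([:: y] ++ A) ++ B by rewrite -catA.
have -> : x :: A ++ y :: B = [:: x] ++ (A ++ [:: y]) ++ B by rewrite -catA.
apply: Teq_cat; first exact: Teq_refl.
by apply: Teq_cat; [exact: Teq_catC | exact: Teq_refl].
Qed.

Fact tensor_scale0 t : tensor_scale 0 t = tensor_zero.
Proof.
apply/tensor_ofP; elim: (repr t) => [|[v w] s IH] /=; first exact: Teq_refl.
by rewrite scale0r -cat1s -[X in tensor_eq _ X]cat0s;
  apply: Teq_cat => //; exact: Teq_0.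
Qed.

Fact tensor_scale1 : left_id 1 tensor_scale.
Proof.
move=> t; rewrite -[t]tensor_of_repr tensor_scaleE; congr tensor_of.
by rewrite -[RHS]map_id; apply: eq_map => -[v w]; rewrite /= scale1r.
Qed.

Fact tensor_addN : left_inverse tensor_zero tensor_opp tensor_add.
Proof.
move=> t; rewrite -{2}[t]tensor_scale1 -tensor_scaleDl addNr.
exact: tensor_scale0.
Qed.

HB.instance Definition _ := GRing.isZmodule.Build tensor
  tensor_addA tensor_addC tensor_add0 tensor_addN.

Fact tensor_scaleA a b t :
  tensor_scale a (tensor_scale b t) = tensor_scale (a * b) t.
Proof.
rewrite -[t]tensor_of_repr !tensor_scaleE; congr tensor_of.
rewrite /scale_formal -map_comp.
by apply: eq_map => -[v w]; rewrite /= scalerA.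
Qed.

Fact tensor_scaleDr : right_distributive tensor_scale +%R.
Proof.
move=> a x y; rewrite -[x]tensor_of_repr -[y]tensor_of_repr.
rewrite [tensor_of _ + _]tensor_addE !tensor_scaleE.
by rewrite [RHS]tensor_addE /scale_formal map_cat.
Qed.

HB.instance Definition _ := GRing.Zmodule_isLmodule.Build K tensor
  tensor_scaleA tensor_scale1 tensor_scaleDr tensor_scaleDl.

Definition tens (v : V) (w : W) : tensor := tensor_of [:: (v, w)].

Lemma tensDl v v' w : tens (v + v') w = tens v w + tens v' w.
Proof. by rewrite [RHS]tensor_addE; apply/tensor_ofP; exact: Teq_Dl. Qed.

Lemma tensDr v w w' : tens v (w + w') = tens v w + tens v w'.
Proof. by rewrite [RHS]tensor_addE; apply/tensor_ofP; exact: Teq_Dr. Qed.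

Lemma tensZl a v w : tens (a *: v) w = a *: tens v w.
Proof. by rewrite [RHS]tensor_scaleE. Qed.

Lemma tensZr a v w : tens v (a *: w) = a *: tens v w.
Proof. by rewrite -tensZl; apply/tensor_ofP/Teq_sym/Teq_Z. Qed.

Lemma tensor_ofE s : tensor_of s = \sum_(p <- s) tens p.1 p.2.
Proof.
elim: s => [|[v w] s IH]; first by rewrite big_nil.
by rewrite big_cons -IH [RHS]tensor_addE.
Qed.

End TensorRelation.

Notation "V ⊗ W" := (tensor V W) (at level 40, left associativity) : type_scope.
Notation "v ⊗ w" := (tens v w) (at level 40, left associativity) : ring_scope.

(** Sweedler sums: [tsum f t] is the value at [t] of the additive map sending
    the pure tensor [v ⊗ w] to [f v w].  It is meaningful whenever [f] is
    balanced (linear or conjugate linear in both variables), by [tsum_tens] and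
    [tsumD] below. *)
Section SweedlerSum.
Variables (K : fieldType) (V W : lmodType K) (Z : zmodType).

Definition tsum (f : V -> W -> Z) (t : (V ⊗ W)%type) : Z :=
  \sum_(p <- repr t) f p.1 p.2.

Definition balanced (f : V -> W -> Z) : Prop :=
  [/\ forall v v' w, f (v + v') w = f v w + f v' w,
      forall v w w', f v (w + w') = f v w + f v w' &
      forall a v w, f (a *: v) w = f v (a *: w)].

Lemma tsum_tensor_of f s :
  balanced f -> tsum f (tensor_of s) = \sum_(p <- s) f p.1 p.2.
Proof.
move=> [fDl fDr fZ]; rewrite /tsum; move: (repr _) (repr_tensor_of s) => r.
elim=> {r s} //=.
- by move=> s t u _ -> _ ->.
- by move=> s s' t t' _ e _ e'; rewrite !big_cat /= e e'.
- by move=> s t; rewrite !big_cat /= addrC.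
- move=> w; rewrite big_seq1 big_nil /=.
  by apply: (addrI (f 0 w)); rewrite -fDl !addr0.
- by move=> v v' w; rewrite !big_cons !big_nil /= fDl !addr0.
- by move=> v w w'; rewrite !big_cons !big_nil /= fDr !addr0.
- by move=> a v w; rewrite !big_seq1 /= fZ.
Qed.

Lemma tsum_tens f v w : balanced f -> tsum f (v ⊗ w) = f v w.
Proof. by move=> fb; rewrite tsum_tensor_of // big_seq1. Qed.

Lemma tsumD f t u : balanced f -> tsum f (t + u) = tsum f t + tsum f u.
Proof. by move=> fb; rewrite [LHS]tsum_tensor_of // big_cat. Qed.

End SweedlerSum.

Notation "'\tsum_' ( x , y <- t ) E" := (tsum (fun x y => E) t)
  (at level 41, x name, y name, t at level 41, E at level 41,
   format "'\tsum_' ( x ,  y  <-  t )  E") : ring_scope.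

HB.mixin Record Lmodule_isCoalgebra (K : fieldType) A of GRing.Lmodule K A := {
  comul : {linear A -> (A ⊗ A)%type};
  counit : {scalar A};
  comulA : forall x : A,
    \tsum_(a, b <- comul x) (\tsum_(a1, a2 <- comul a) (a1 ⊗ a2) ⊗ b) =
    \tsum_(a, b <- comul x) (\tsum_(b1, b2 <- comul b) (a ⊗ b1) ⊗ b2);
  counitl : forall x : A, \tsum_(a, b <- comul x) (counit a *: b) = x;
  counitr : forall x : A, \tsum_(a, b <- comul x) (counit b *: a) = x
}.

#[short(type="coalgType")]
HB.structure Definition Coalgebra (K : fieldType) :=
  {A of GRing.Lmodule K A & Lmodule_isCoalgebra K A}.

HB.mixin Record Algebra_isHopf (K : fieldType) H
    of GRing.Algebra K H & Coalgebra K H := {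
  antipode : {linear H -> H};
  comul1 : comul (1 : H) = 1 ⊗ 1;
  comulM : forall x y : H, comul (x * y) =
    \tsum_(a, b <- comul x) \tsum_(c, d <- comul y) (a * c) ⊗ (b * d);
  counit1 : counit (1 : H) = 1;
  counitM : forall x y : H, counit (x * y) = counit x * counit y;
  antipodel : forall x : H,
    \tsum_(a, b <- comul x) (antipode a * b) = (counit x)%:A;
  antipoder : forall x : H,
    \tsum_(a, b <- comul x) (a * antipode b) = (counit x)%:A
}.

#[short(type="hopfAlgType")]
HB.structure Definition Hopf (K : fieldType) :=
  {H of GRing.Algebra K H & Coalgebra K H & Algebra_isHopf K H}.

HB.mixin Record Lmodule_isComodule (K : fieldType) (A : coalgType K) V
    of GRing.Lmodule K V := {
  coact : {linear V -> (V ⊗ A)%type};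
  coactA : forall v : V,
    \tsum_(v0, v1 <- coact v) (\tsum_(v00, v01 <- coact v0) (v00 ⊗ v01) ⊗ v1) =
    \tsum_(v0, v1 <- coact v) (\tsum_(a1, a2 <- comul v1) (v0 ⊗ a1) ⊗ a2);
  coact_counit : forall v : V, \tsum_(v0, v1 <- coact v) (counit v1 *: v0) = v
}.

#[short(type="comodType")]
HB.structure Definition Comodule (K : fieldType) (A : coalgType K) :=
  {V of GRing.Lmodule K V & Lmodule_isComodule K A V}.

Section HopfAutomorphism.
Variables (K : fieldType) (H : hopfAlgType K).

Definition coalgebra_morphism (P : H -> H) : Prop :=
  (forall x, comul (P x) = \tsum_(a, b <- comul x) (P a ⊗ P b)) /\
  (forall x, counit (P x) = counit x).

Definition hopf_automorphism (P : {lrmorphism H -> H}) : Prop :=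
  [/\ bijective P, coalgebra_morphism P &
      forall x, antipode (P x) = P (antipode x)].

End HopfAutomorphism.

Section NormalIntegral.
Local Open Scope classical_set_scope.
Variables (K : fieldType) (H : hopfAlgType K).

Definition subspace (D : set H) : Prop :=
  D 0 /\ forall (a : K) x y, D x -> D y -> D (a *: x + y).

Definition subcoalgebra (D : set H) : Prop :=
  subspace D /\
  forall x, D x -> exists s : seq (H * H),
    (forall p, p \in s -> D p.1 /\ D p.2) /\
    comul x = \sum_(p <- s) p.1 ⊗ p.2.

Definition simple_subcoalgebra (D : set H) : Prop :=
  [/\ subcoalgebra D, D <> [set 0] &
      forall E, subcoalgebra E -> E `<=` D -> E = [set 0] \/ E = D].

Definition scalars : set H := [set a%:A | a in [set: K]].

Definition other_simple_sum : set H :=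
  [set x | exists s : seq H,
     (forall y, y \in s ->
        exists D, [/\ simple_subcoalgebra D, D <> scalars & D y]) /\
     x = \sum_(y <- s) y].

(** When [H] is cosemisimple, it is the direct sum of [scalars] and
    [other_simple_sum], so exactly one [c] satisfies the condition below. *)
Definition normal_integral (x : H) : K :=
  xget 0 [set c | other_simple_sum (x - c%:A)].

End NormalIntegral.

Section CompactQuantumGroup.
Variable R : realType.

Definition conjugate_linear (V W : lmodType R[i]) (f : V -> W) : Prop :=
  linear_for (@Num.conj R[i] \; *:%R) f.

Definition circ_structure (A : coalgType R[i]) (circ : A -> A) : Prop :=
  [/\ conjugate_linear circ, involutive circ &
      forall c : A, comul (circ c) = \tsum_(a, b <- comul c) (circ b ⊗ circ a)].

Definition circ_Hopf (H : hopfAlgType R[i]) (circ : H -> H) : Prop :=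
  circ_structure circ /\ {morph circ : x y / x * y}.

Definition unitary (H : hopfAlgType R[i]) (circ : H -> H) (V : comodType H)
    (f : {dot V for @Num.conj R[i]}) : Prop :=
  forall u v : V,
    \tsum_(u0, u1 <- coact u) (f u0 v *: u1) =
    \tsum_(v0, v1 <- coact v) (f u v0 *: circ v1).

Definition compact_quantum_group (H : hopfAlgType R[i]) (circ : H -> H) : Prop :=
  circ_Hopf circ /\
  forall V : comodType H, exists f : {dot V for @Num.conj R[i]}, unitary circ f.

Definition circ_dot (H : hopfAlgType R[i]) (circ : H -> H) (x y : H) : R[i] :=
  normal_integral (antipode (circ y) * x).

(** The order of [R[i]] makes [0 < z] mean that [z] is real and positive. *)
Definition positive_operator (H : hopfAlgType R[i]) (circ : H -> H)
    (L : {linear H -> H}) : Prop :=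
  (forall x y, circ_dot circ (L x) y = circ_dot circ x (L y)) /\
  (forall x, x != 0 -> 0 < circ_dot circ (L x) x).

End CompactQuantumGroup.

(* Main.v *)
(** A unitary inner product [f] on the regular comodule [H] gives the
    normalized two-sided integral [phi x = f x 1 / f 1 1].  Convolving [f] with
    its transport along the inverse antipode gives an inner product [k] on [H]
    that is invariant on both sides, whence [k x y = <x, K y>] and
    [k x (K y) = (k ⊗ k) (Δ x) (Δ y)] for an operator [K] given by a right
    convolution.  Convolution operators are locally finite, so [K] is bijective,
    and the second identity forces [<x, y> = phi (S (y°) x)] to be hermitian and
    positive definite.

    Let [L = ◊°].  It is a self-adjoint Hopf automorphism, so [M = L^2] is
    positive.  Computing the form [(<,> ⊗ <M _, _>) (Δ x) (Δ y)] by invariance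
    on either side yields [M E' = E] with [E'] an injective left convolution and
    [E] a right convolution; hence [M] is locally finite and [H] is spanned by
    eigenvectors of [M] with positive eigenvalues.  [P = M^(1/4)] is again a
    Hopf automorphism.  Both involutions conjugate [M] to its inverse, so
    [P° = °P^-1] and [P◊ = ◊P^-1], which with [P^4 = L^2] gives the
    commutation.  If [◊] is compact too, then [<L^-1 x, x> = phi (S (x◊) x)]
    is positive, so [L = P^2]. *)

From HB Require Import structures.
Require Import Defs.
From mathcomp Require Import all_boot all_order all_algebra.
From mathcomp Require Import sesquilinear.
From mathcomp Require Import boolp classical_sets reals.
From mathcomp Require Import complex.

Set Implicit Arguments.
Unset Strict Implicit.
Unset Printing Implicit Defensive.

Import Order.TTheory GRing.Theory Num.Theory.
Local Open Scope ring_scope.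

(** * Sweedler sums *)

(** Two obstacles shape the argument. Positivity of <,> cannot be read off from [f]: [f] is
    invariant on one side, while on the other side the pairing phi (S z x) is invariant only up to
    S^2, which need not be the identity. Transporting [f] along the inverse antipode produces
    exactly this S^2 twist, so the convolved form and the pairing obey the same two rules and can be
    compared through their convolutions. The second obstacle is that a Hopf automorphism may move
    simple subcoalgebras along infinite orbits, so nothing formal gives M an eigenvector. The remedy
    is to write M as E followed by the inverse of E': convolutions keep x inside a
    finite-dimensional subcoalgebra. L itself may have negative eigenvalues, hence the passage to
    L^2. Since P° = °P^-1 gives P°P^-1 = P^2°, commuting with ◊ amounts to P^4 = L^2, which dictates
    the exponent 1/4. Cosemisimplicity serves to identify phi with the projection
    [normal_integral]. *)

Lemma eq_tsum (K : fieldType) (U V : lmodType K) (Z : zmodType)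
    (f g : U -> V -> Z) t :
  (forall x y, f x y = g x y) -> tsum f t = tsum g t.
Proof. by move=> fg; apply: eq_bigr. Qed.

(** Linearity is a predicate on bare functions because most maps below are anonymous Sweedler
    expressions, which the tactic [lin] analyses by their syntax. Scalar-valued maps take the field
    as a module over itself, whence [slin] and [sbilin]. *)
Definition lin (K : fieldType) (V W : lmodType K) (f : V -> W) : Prop :=
  forall a u v, f (a *: u + v) = a *: f u + f v.

Notation slin f := (@lin _ _ _^o f).

Definition bilin (K : fieldType) (U V W : lmodType K) (f : U -> V -> W) :=
  (forall v, lin (fun u => f u v)) /\ (forall u, lin (fun v => f u v)).

Notation sbilin f := (@bilin _ _ _ _^o f).

Definition trilin (K : fieldType) (U V W Z : lmodType K)
    (f : U -> V -> W -> Z) :=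
  [/\ forall v w, lin (fun u => f u v w), forall u w, lin (fun v => f u v w)
    & forall u v, lin (fun w => f u v w)].

Section Lin.
Variables (K : fieldType) (V W : lmodType K).

Lemma linD (f : V -> W) u v : lin f -> f (u + v) = f u + f v.
Proof. by move=> fl; rewrite -[u]scale1r fl !scale1r. Qed.

Lemma lin0 (f : V -> W) : lin f -> f 0 = 0.
Proof.
by move=> fl; apply: (addrI (f 0)); rewrite -linD // !addr0.
Qed.

Lemma linZ (f : V -> W) a u : lin f -> f (a *: u) = a *: f u.
Proof. by move=> fl; rewrite -[a *: u]addr0 fl lin0 // addr0. Qed.

Lemma linN (f : V -> W) u : lin f -> f (- u) = - f u.
Proof. by move=> fl; rewrite -scaleN1r linZ // scaleN1r. Qed.

Lemma linB (f : V -> W) u v : lin f -> f (u - v) = f u - f v.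
Proof. by move=> fl; rewrite linD // linN. Qed.

Lemma lin_sum (f : V -> W) I (r : seq I) (P : pred I) F :
  lin f -> f (\sum_(i <- r | P i) F i) = \sum_(i <- r | P i) f (F i).
Proof.
move=> fl; apply: (big_morph f) => [x y|]; [exact: linD|exact: lin0].
Qed.

End Lin.
Arguments linD {K V W f} u v _.
Arguments linZ {K V W f} a u _.

Section LinearClosure.
Variables (K : fieldType) (U V W Z : lmodType K).

Lemma lin_id : lin (fun x : V => x).
Proof. by []. Qed.

Lemma lin_linear (f : {linear V -> W}) : lin f.
Proof. by move=> a u v; rewrite linearP. Qed.

Lemma lin_comp (f : V -> W) (g : U -> V) :
  lin f -> lin g -> lin (fun x => f (g x)).
Proof. by move=> fl gl a u v; rewrite gl fl. Qed.

Lemma lin_add (f g : V -> W) : lin f -> lin g -> lin (fun x => f x + g x).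
Proof. by move=> fl gl a u v; rewrite fl gl scalerDr addrACA. Qed.

Lemma lin_opp (f : V -> W) : lin f -> lin (fun x => - f x).
Proof. by move=> fl a u v; rewrite fl opprD scalerN. Qed.

Lemma lin_bigsum I (r : seq I) (f : I -> V -> W) :
  (forall i, lin (f i)) -> lin (fun x => \sum_(i <- r) f i x).
Proof.
move=> fl a u v; rewrite scaler_sumr -big_split /=.
by apply: eq_bigr => i _; exact: fl.
Qed.

End LinearClosure.

Section BilinearApplication.
Variables (K : fieldType) (U V W Z : lmodType K).

Lemma lin_scalel (f : V -> K) (w : W) :
  slin f -> lin (fun x => f x *: w).
Proof. by move=> fl a u v; rewrite fl scalerDl scalerA. Qed.

Lemma lin_scaler (f : V -> W) a : lin f -> lin (fun x => a *: f x).
Proof. by move=> fl b u v; rewrite fl scalerDr !scalerA mulrC. Qed.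

Lemma lin_app1 (B : U -> V -> W) (g : Z -> U) v :
  bilin B -> lin g -> lin (fun x => B (g x) v).
Proof. by move=> [Bl _] gl a u w; rewrite gl Bl. Qed.

Lemma lin_app2 (B : U -> V -> W) (g : Z -> V) u :
  bilin B -> lin g -> lin (fun x => B u (g x)).
Proof. by move=> [_ Bl] gl a v w; rewrite gl Bl. Qed.

End BilinearApplication.

Section BalancedSums.
Variables (K : fieldType) (U V W Z : lmodType K).

Lemma balanced_bilin (f : U -> V -> W) : bilin f -> balanced f.
Proof.
move=> [fl fr]; split=> [v v' w|v w w'|a v w].
- by have := linD v v' (fl w).
- by have := linD w w' (fr v).
- by have /= -> := linZ a v (fl w); have /= -> := linZ a w (fr v).
Qed.

Lemma tsumB (f g : U -> V -> W) t :
  tsum (fun x y => f x y - g x y) t = tsum f t - tsum g t.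
Proof. exact: sumrB. Qed.

End BalancedSums.

Section SumClosure.
Variables (K : fieldType) (U V W Z : lmodType K).

Lemma lin_tsum (f : Z -> U -> V -> W) t :
  (forall x y, lin (fun z => f z x y)) -> lin (fun z => tsum (f z) t).
Proof.
move=> fl; apply: (lin_bigsum (repr t) (f := fun p z => f z p.1 p.2)) => p.
exact: fl.
Qed.

End SumClosure.

Section TensorSums.
Variables (K : fieldType) (U V W Z : lmodType K).

Lemma lin_tsumr (f : U -> V -> W) (g : Z -> (U ⊗ V)%type) :
  bilin f -> lin g -> lin (fun z => tsum f (g z)).
Proof.
move=> fb gl a u v; have fB := balanced_bilin fb.
rewrite gl tsumD //; congr (_ + _).
rewrite -[g u]tensor_of_repr [a *: _]tensor_scaleE !tsum_tensor_of //.
rewrite big_map scaler_sumr; apply: eq_bigr => p _ /=.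
by case: fb => + _ => /(_ p.2); exact: linZ.
Qed.

Lemma linear_tsum (h : W -> Z) (f : U -> V -> W) t :
  lin h -> h (tsum f t) = tsum (fun x y => h (f x y)) t.
Proof. by move=> hl; exact: (@lin_sum _ _ _ h). Qed.

Lemma tsum_pure (f : U -> V -> W) u v : bilin f -> tsum f (u ⊗ v) = f u v.
Proof. by move/balanced_bilin; exact: tsum_tens. Qed.

Lemma tsum_id (t : (U ⊗ V)%type) : \tsum_(x, y <- t) (x ⊗ y) = t.
Proof. by rewrite /tsum -tensor_ofE tensor_of_repr. Qed.

End TensorSums.
Arguments linear_tsum {K U V W Z h} f t _.

Lemma slinear_tsum (K : fieldType) (U V W : lmodType K) (h : W -> K)
    (f : U -> V -> W) t :
  slin h -> h (tsum f t) = tsum (fun x y => h (f x y)) t.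
Proof. by move=> hl; exact: (linear_tsum (h := h : W -> K^o)). Qed.
Arguments slinear_tsum {K U V W h} f t _.

Lemma slinZ (K : fieldType) (V : lmodType K) (h : V -> K) a x :
  slin h -> h (a *: x) = a * h x.
Proof. by move=> hl; exact: (linZ (f := h : V -> K^o)). Qed.
Arguments slinZ {K V h} a x _.

Lemma tensor_ext (K : fieldType) (U V W : lmodType K)
    (f g : (U ⊗ V)%type -> W) t :
  lin f -> lin g -> (forall u v, f (u ⊗ v) = g (u ⊗ v)) -> f t = g t.
Proof.
move=> fl gl fg; rewrite -[t]tsum_id !linear_tsum //.
exact: eq_tsum.
Qed.

Lemma bilin_tens (K : fieldType) (U V : lmodType K) : bilin (@tens K U V).
Proof.
by split=> [v|u] a x y; rewrite ?tensDl ?tensDr ?tensZl ?tensZr.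
Qed.

Lemma exchange_tsum (K : fieldType) (U V U' V' : lmodType K)
    (W : zmodType) (f : U -> V -> U' -> V' -> W) s t :
  \tsum_(a, b <- s) \tsum_(c, d <- t) f a b c d =
  \tsum_(c, d <- t) \tsum_(a, b <- s) f a b c d.
Proof. exact: exchange_big. Qed.

Lemma tensNl (K : fieldType) (U V : lmodType K) (u : U) (v : V) :
  (- u) ⊗ v = - (u ⊗ v).
Proof. by rewrite -scaleN1r tensZl scaleN1r. Qed.

Lemma tensNr (K : fieldType) (U V : lmodType K) (u : U) (v : V) :
  u ⊗ (- v) = - (u ⊗ v).
Proof. by rewrite -scaleN1r tensZr scaleN1r. Qed.

Lemma bilin_mul (K : fieldType) (A : algType K) : bilin (@GRing.mul A).
Proof.
by split=> [v|u] a x y; [rewrite mulrDl scalerAl | rewrite mulrDr scalerAr].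
Qed.

Lemma slin_counit (K : fieldType) (A : coalgType K) :
  slin (fun x : A => counit x).
Proof. by move=> a u v; rewrite linearP. Qed.

Lemma slin_mull (K : fieldType) (V : lmodType K) (f : V -> K) (c : K) :
  slin f -> slin (fun x => f x * c).
Proof. by move=> fl a u v; rewrite fl mulrDl /GRing.scale /= mulrA. Qed.

Lemma slin_mulr (K : fieldType) (V : lmodType K) (f : V -> K) (c : K) :
  slin f -> slin (fun x => c * f x).
Proof. by move=> fl a u v; rewrite fl mulrDr /GRing.scale /= mulrCA. Qed.

Ltac lin_binary W B f g H :=
  lazymatch g with
  | (fun _ => ?w) => refine (@lin_app1 _ _ _ W _ B f w H _)
  | _ => lazymatch f with
    | (fun _ => ?w) => refine (@lin_app2 _ _ _ W _ B g w H _)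
    end
  end.

(* Solves linearity goals by following the syntax of the function; hypotheses
   of the form [lin _] and [bilin _] in the context are used for its atoms. *)
Ltac lin :=
  lazymatch goal with
  | |- forall _, _ => intro; lin
  | |- bilin _ => split; lin
  | |- trilin _ => split; lin
  | |- @lin ?K ?V ?W ?f =>
      let g := eval cbv beta in (fun x => f x) in
      change (@lin K V W g); lin_body
  end
with lin_body :=
  lazymatch goal with
  | |- lin (fun x => x) => exact: lin_id
  | |- @lin _ _ ?W (fun x => tsum (@?f x) (@?t x)) =>
      lazymatch t with
      | (fun _ => ?t0) => refine (@lin_tsum _ _ _ W _ f t0 _)
      | _ => lazymatch f with
        | (fun _ => ?f0) => refine (@lin_tsumr _ _ _ W _ f0 t _ _)
        end
      end; lin
  | |- lin (fun x => counit (@?g x)) =>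
      refine (@lin_comp _ _ _ _ _ g (@slin_counit _ _) _); lin
  | |- @lin _ _ ?W (fun x => GRing.scale (@?f x) (@?g x)) =>
      lazymatch g with
      | (fun _ => ?w) => refine (@lin_scalel _ _ W f w _)
      | _ => lazymatch f with
        | (fun _ => ?w) => refine (@lin_scaler _ _ W g w _)
        end
      end; lin
  | |- @lin _ _ ?W (fun x => tens (@?f x) (@?g x)) =>
      lin_binary W uconstr:(_) f g uconstr:(@bilin_tens _ _ _); lin
  | |- @lin _ _ ?W (fun x => GRing.mul (@?f x) (@?g x)) =>
      first
        [ lin_binary W uconstr:(_) f g uconstr:(@bilin_mul _ _)
        | lazymatch g with
          | (fun _ => ?w) => refine (@slin_mull _ _ f w _)
          | _ => lazymatch f with
            | (fun _ => ?w) => refine (@slin_mulr _ _ g w _)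
            end
          end ]; lin
  | |- @lin _ _ ?W (fun x => GRing.add (@?f x) (@?g x)) =>
      refine (@lin_add _ _ W f g _ _); lin
  | |- @lin _ _ ?W (fun x => GRing.opp (@?f x)) =>
      refine (@lin_opp _ _ W f _); lin
  | |- @lin _ _ ?W _ =>
      match goal with
      | |- _ => assumption
      | H : bilin ?B |- lin (fun x => ?B (@?f x) (@?g x)) =>
          lin_binary W B f g H; lin
      | |- lin (fun x => ?f (@?g x)) =>
          refine (@lin_comp _ _ _ W f g _ _);
            [first [assumption | exact: lin_linear] | lin]
      end
  end.

Section Sweedler.
Variables (K : fieldType) (A : coalgType K) (V : lmodType K).

Lemma lin_comul : lin (@comul K A). Proof. exact: lin_linear. Qed.

(** A trilinear [g] induces a linear map [G] on the triple tensor product; apply it to both sides of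
    [comulA]. *)
Lemma coassoc (g : A -> A -> A -> V) x : trilin g ->
  \tsum_(a, b <- comul x) \tsum_(a1, a2 <- comul a) g a1 a2 b =
  \tsum_(a, b <- comul x) \tsum_(b1, b2 <- comul b) g a b1 b2.
Proof.
move=> [g1 g2 g3].
pose G (t : (A ⊗ A ⊗ A)%type) :=
  \tsum_(s, c <- t) \tsum_(a, b <- s) g a b c.
have gc c : bilin (fun a b => g a b c) by split=> ?; [exact: g1|exact: g2].
have G2 : bilin (fun s c => \tsum_(a, b <- s) g a b c).
  split; first by move=> c; apply: lin_tsumr; [exact: gc|exact: lin_id].
  by move=> s; apply: lin_tsum => a b; exact: g3.
have Gl : lin G by apply: lin_tsumr => //; exact: lin_id.
have Gt a b c : G (a ⊗ b ⊗ c) = g a b c by rewrite /G !tsum_pure.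
have /(congr1 G) := comulA x.
rewrite !(linear_tsum _ _ Gl) => E.
transitivity (\tsum_(a, b <- comul x)
    G (\tsum_(a1, a2 <- comul a) (a1 ⊗ a2) ⊗ b)).
  by apply: eq_tsum => a b; rewrite (linear_tsum _ _ Gl); exact: eq_tsum.
rewrite E; apply: eq_tsum => a b; rewrite (linear_tsum _ _ Gl).
exact: eq_tsum.
Qed.

Lemma counit_l (f : A -> V) x : lin f ->
  \tsum_(a, b <- comul x) (counit a *: f b) = f x.
Proof.
move=> fl; rewrite -[in RHS](counitl x) linear_tsum //.
by apply: eq_tsum => a b; rewrite linZ.
Qed.

Lemma counit_r (f : A -> V) x : lin f ->
  \tsum_(a, b <- comul x) (counit b *: f a) = f x.
Proof.
move=> fl; rewrite -[in RHS](counitr x) linear_tsum //.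
by apply: eq_tsum => a b; rewrite linZ.
Qed.

(** In the convolution algebra of maps from [A] to [V], a left inverse and a right inverse of [g]
    agree: f = f(gh) = (fg)h = h. The product [m] is a parameter so that it can be the product of H
    ⊗ H or the opposite product of H. *)
Lemma conv_inv_uniq (m : V -> V -> V) (e : V) (f g h : A -> V) :
  bilin m -> associative m -> left_id e m -> right_id e m ->
  lin f -> lin g -> lin h ->
  (forall x, \tsum_(a, b <- comul x) m (f a) (g b) = counit x *: e) ->
  (forall x, \tsum_(a, b <- comul x) m (g a) (h b) = counit x *: e) ->
  f =1 h.
Proof.
move=> mb mA e1 e2 fl gl hl fg gh x.
have ml v : lin (m v) by case: mb.
have mr v : lin (m^~ v) by case: mb.
rewrite -(counit_r x fl) -(counit_l x hl).
transitivity (\tsum_(a, b <- comul x) \tsum_(c, d <- comul b)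
    m (f a) (m (g c) (h d))).
  apply: eq_tsum => a b; rewrite -(linear_tsum _ _ (ml (f a))) gh.
  by rewrite linZ // e2.
rewrite -(@coassoc (fun a c d => m (f a) (m (g c) (h d)))); last lin.
apply: eq_tsum => a b.
rewrite -[in RHS](e1 (h b)) -(linZ _ _ (mr (h b))) -fg.
by rewrite (linear_tsum _ _ (mr (h b))); apply: eq_tsum => c d; rewrite mA.
Qed.

End Sweedler.

(** * Antipode *)

Lemma tsum_tsum (K : fieldType) (U V U' V' : lmodType K) (Z : zmodType)
    (f : U -> V -> Z) (g : U' -> V' -> (U ⊗ V)%type) s :
  balanced f -> tsum f (tsum g s) = \tsum_(a, b <- s) tsum f (g a b).
Proof.
move=> fb; apply: (big_morph (tsum f)) => [x y|]; first exact: tsumD.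
by apply: (addrI (tsum f 0)); rewrite -tsumD // !addr0.
Qed.

Section TensorAlgebra.
Variables (K : fieldType) (A : algType K).

Definition mult (s t : (A ⊗ A)%type) : (A ⊗ A)%type :=
  \tsum_(a, b <- s) \tsum_(c, d <- t) (a * c) ⊗ (b * d).

Lemma bilin_mult : bilin mult.
Proof. by rewrite /mult; lin. Qed.

Lemma mult_pure a b c d : mult (a ⊗ b) (c ⊗ d) = (a * c) ⊗ (b * d).
Proof. by rewrite /mult !tsum_pure //; lin. Qed.

Lemma multA : associative mult.
Proof.
move=> x y z; have mb := bilin_mult.
apply: (@tensor_ext _ _ _ _ (fun x => mult x (mult y z))
  (fun x => mult (mult x y) z)); [lin|lin|move=> a b].
apply: (@tensor_ext _ _ _ _ (fun y => mult (a ⊗ b) (mult y z))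
  (fun y => mult (mult (a ⊗ b) y) z)); [lin|lin|move=> c d].
apply: (@tensor_ext _ _ _ _ (fun z => mult (a ⊗ b) (mult (c ⊗ d) z))
  (fun z => mult (mult (a ⊗ b) (c ⊗ d)) z)); [lin|lin|move=> e f].
by rewrite !mult_pure !mulrA.
Qed.

Lemma mult1l : left_id (1 ⊗ 1) mult.
Proof.
move=> x; have mb := bilin_mult.
apply: (@tensor_ext _ _ _ _ (mult (1 ⊗ 1)) (fun x => x)); [lin|lin|move=> a b].
by rewrite mult_pure !mul1r.
Qed.

Lemma mult1r : right_id (1 ⊗ 1) mult.
Proof.
move=> x; have mb := bilin_mult.
apply: (@tensor_ext _ _ _ _ (mult^~ (1 ⊗ 1)) (fun x => x)); [lin|lin|].
move=> a b.
by rewrite mult_pure !mulr1.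
Qed.

End TensorAlgebra.
Arguments mult {K A} s t.

Section Antipode.
Variables (K : fieldType) (H : hopfAlgType K).

Lemma comul_mult (x y : H) : comul (x * y) = mult (comul x) (comul y).
Proof. exact: comulM. Qed.

(** Both sides are convolution inverses of [comul] among the maps from H to H ⊗ H. *)
Lemma comul_antipode (x : H) :
  comul (antipode x) = \tsum_(a, b <- comul x) antipode b ⊗ antipode a.
Proof.
apply: (@conv_inv_uniq _ _ _ (@mult K H) (1 ⊗ 1)
  (fun x => comul (antipode x)) (fun x => comul x)
  (fun x => \tsum_(a, b <- comul x) antipode b ⊗ antipode a) (@bilin_mult _ _)
  (@multA _ _) (@mult1l _ _) (@mult1r _ _)); [lin|lin|lin| |] => {}x.
  under eq_tsum => a b do rewrite -comul_mult.
  by rewrite -(linear_tsum _ _ (@lin_comul K H)) antipodel linearZ comul1.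
have mb := @bilin_mult K H.
transitivity (\tsum_(a, b <- comul x) \tsum_(a1, a2 <- comul a)
    \tsum_(c, d <- comul b) (a1 * antipode d) ⊗ (a2 * antipode c)).
  apply: eq_tsum => a b; have ml v : lin (mult v) := (proj2 mb v).
  rewrite -{1}[comul a]tsum_id.
  rewrite (linear_tsum (h := fun s => mult s _)); last lin.
  apply: eq_tsum => a1 a2; rewrite linear_tsum //.
  by apply: eq_tsum => c d; rewrite mult_pure.
rewrite (coassoc (g := fun a1 a2 b =>
  \tsum_(c, d <- comul b) (a1 * antipode d) ⊗ (a2 * antipode c))); last lin.
transitivity (\tsum_(a, b <- comul x) (a * antipode b) ⊗ (1 : H)).
  apply: eq_tsum => a b.
  rewrite -(coassoc (g := fun a2 c d => (a * antipode d) ⊗ (a2 * antipode c)));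
    last lin.
  rewrite -[RHS](@counit_l _ _ _ (fun b => (a * antipode b) ⊗ (1 : H)));
    last lin.
  apply: eq_tsum => b1 b2; rewrite -tensZr -antipoder.
  by rewrite (linear_tsum (h := fun y => (a * antipode b2) ⊗ y)) //; lin.
rewrite -(linear_tsum (h := fun y => y ⊗ (1 : H)) (fun a b => a * antipode b));
  last lin.
by rewrite antipoder tensZl.
Qed.

Lemma counit_antipode (x : H) : counit (antipode x) = counit x.
Proof.
transitivity (counit (\tsum_(a, b <- comul x) (antipode a * b))); last first.
  by rewrite antipodel linearZ /= counit1 mulr1.
rewrite -[in LHS](counitr x).
rewrite (slinear_tsum (h := fun x => counit (antipode x))); last lin.
rewrite (slinear_tsum (h := counit)); last lin.
by apply: eq_tsum => a b; rewrite counitM !linearZ /= mulrC.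
Qed.

(** Both composites are convolution inverses of [P]. *)
Lemma morphism_antipode (P : {lrmorphism H -> H}) :
  coalgebra_morphism P -> forall x, antipode (P x) = P (antipode x).
Proof.
move=> [Pc Pe] x; symmetry.
have Pl : lin (P : H -> H) by move=> a u v; rewrite linearP.
apply: (@conv_inv_uniq _ H H (@GRing.mul H) 1
  (fun x => P (antipode x)) P (fun x => antipode (P x)) (@bilin_mul _ _)
  (@mulrA _) (@mul1r _) (@mulr1 _)); [lin|lin|lin| |] => {}x.
  under eq_tsum => a b do rewrite -rmorphM.
  by rewrite -(linear_tsum _ _ Pl) antipodel linearZ rmorph1.
rewrite -Pe -antipoder Pc.
rewrite -[RHS]/((fun t => \tsum_(a, b <- t) (a * antipode b)) _).
rewrite linear_tsum; last lin.
by apply: eq_tsum => a b; rewrite tsum_pure //; lin.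
Qed.

End Antipode.

(** * Involutions *)

Section CircStructure.
Variables (R : realType) (H : hopfAlgType R[i]) (circ : H -> H).
Hypothesis circH : circ_Hopf circ.

Lemma circD x y : circ (x + y) = circ x + circ y.
Proof.
case: circH => -[cl _ _] _; have := cl 1 x y.
by rewrite scale1r => -> /=; rewrite rmorph1 scale1r.
Qed.

Lemma circ0 : circ 0 = 0.
Proof. by apply: (addrI (circ 0)); rewrite -circD !addr0. Qed.

Lemma circZ a x : circ (a *: x) = a^* *: circ x.
Proof.
case: circH => -[cl _ _] _; have := cl a x 0.
by rewrite addr0 circ0 addr0.
Qed.

Lemma circK : involutive circ.
Proof. by case: circH => -[]. Qed.

Lemma circM x y : circ (x * y) = circ x * circ y.
Proof. by case: circH => _; exact. Qed.

Lemma circ1 : circ 1 = 1.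
Proof. by rewrite -[LHS]mulr1 -{2}(circK 1) -circM mul1r circK. Qed.

Lemma circ_tsum (U V : lmodType R[i]) (f : U -> V -> H) t :
  circ (tsum f t) = \tsum_(x, y <- t) circ (f x y).
Proof. by apply: (big_morph circ) => [x y|]; [exact: circD|exact: circ0]. Qed.

Lemma comul_circ x : comul (circ x) = \tsum_(a, b <- comul x) circ b ⊗ circ a.
Proof. by case: circH => -[]. Qed.

Lemma tsum_comul_circ (Z : zmodType) (f : H -> H -> Z) x : balanced f ->
  tsum f (comul (circ x)) = \tsum_(a, b <- comul x) f (circ b) (circ a).
Proof.
move=> fb; rewrite comul_circ tsum_tsum //.
by apply: eq_bigr => p _; rewrite tsum_tens.
Qed.

(** The functional [c] is a right counit because ° flips [comul], and a right counit equals the left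
    one: c(x) = sum of counit(a) c(b) = counit(x). *)
Lemma counit_circ x : counit (circ x) = (counit x)^*.
Proof.
pose c x := (counit (circ x))^* : R[i].
have cl : slin c.
  move=> a u v; rewrite /c circD circZ linearD linearZ /= rmorphD rmorphM /=.
  by rewrite conjCK.
have ce y : \tsum_(a, b <- comul y) (c b *: a) = y.
  rewrite -[RHS](circK y) -[in RHS](counitl (circ y)) circ_tsum.
  rewrite tsum_comul_circ; first by apply: eq_tsum => a b; rewrite circZ circK.
  split=> [v v' w|v w w'|a v w].
  - by rewrite linearD scalerDl circD.
  - by rewrite scalerDr circD.
  - by rewrite linearZ scalerA mulrC.
rewrite -[LHS]conjCK -/(c x); congr (_^* ).
rewrite -[in LHS](counitl x) -[in RHS](ce x).
rewrite (slinear_tsum (h := c)) //.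
rewrite (slinear_tsum (h := counit)); last exact: slin_counit.
apply: eq_tsum => a b; rewrite (slinZ (h := c)) // linearZ.
exact: mulrC.
Qed.

Definition circ_antipode x := circ (antipode (circ x)).

Lemma lin_circ_antipode : lin circ_antipode.
Proof.
move=> a u v; rewrite /circ_antipode circD circZ linearD linearZ.
by rewrite circD circZ conjCK.
Qed.

Lemma comul_circ_antipode x : comul (circ_antipode x) =
  \tsum_(a, b <- comul x) circ_antipode b ⊗ circ_antipode a.
Proof.
rewrite comul_circ comul_antipode tsum_comul_circ; last first.
  by apply: balanced_bilin; lin.
rewrite tsum_tsum; last first.
  split=> [v v' w|v w w'|a v w].
  - by rewrite circD tensDr.
  - by rewrite circD tensDl.
  - by rewrite !circZ tensZl tensZr.
apply: eq_tsum => a b; rewrite tsum_tens //.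
split=> [v v' w|v w w'|k v w].
- by rewrite circD tensDr.
- by rewrite circD tensDl.
- by rewrite !circZ tensZl tensZr.
Qed.

Lemma circ_antipode_l x :
  \tsum_(a, b <- comul x) (circ_antipode b * a) = (counit x)%:A.
Proof.
rewrite -[RHS]circK circZ circ1 -counit_circ -antipodel.
rewrite tsum_comul_circ; last by apply: balanced_bilin; lin.
by rewrite circ_tsum; apply: eq_tsum => a b; rewrite circM circK.
Qed.

(** For the opposite product, the identity and the composite on the left are both convolution
    inverses of [circ_antipode]. This is how the involution makes the antipode invertible. *)
Lemma antipode_circ_antipode x : antipode (circ_antipode x) = x.
Proof.
have tl := lin_circ_antipode; symmetry.
apply: (@conv_inv_uniq _ H H (fun u v => v * u) 1 (fun x => x)
   circ_antipode (fun x => antipode (circ_antipode x))).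
- lin.
- by move=> a b c; rewrite mulrA.
- by move=> a; rewrite mulr1.
- by move=> a; rewrite mul1r.
- lin.
- exact: tl.
- lin.
- by move=> y; rewrite circ_antipode_l.
move=> y; rewrite -[RHS](_ : (counit (circ_antipode y))%:A = _); last first.
  by rewrite /circ_antipode counit_circ counit_antipode counit_circ conjCK.
rewrite -antipodel comul_circ_antipode.
rewrite tsum_tsum; last by apply: balanced_bilin; lin.
by apply: eq_tsum => a b; rewrite tsum_pure //; lin.
Qed.

End CircStructure.

(** * Integrals and invariant forms *)

Section Integral.
Variables (K : fieldType) (H : hopfAlgType K).
Implicit Types (phi psi : H -> K) (B : H -> H -> K).

Definition right_integral phi := [/\ slin phi, phi 1 = 1 &
  forall x, \tsum_(a, b <- comul x) (phi a *: b) = (phi x)%:A].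

Definition left_integral phi := [/\ slin phi, phi 1 = 1 &
  forall x, \tsum_(a, b <- comul x) (phi b *: a) = (phi x)%:A].

(** Both values equal (phi ⊗ psi)(Δ x). This is the source of every symmetry of the integral: under
    °, under automorphisms, and between two involutions. *)
Lemma integral_uniq phi psi :
  right_integral phi -> left_integral psi -> phi =1 psi.
Proof.
move=> [phil phi1 phiE] [psil psi1 psiE] x.
transitivity (psi (phi x)%:A).
  by rewrite (slinZ (h := psi)) // psi1  mulr1.
transitivity (phi (psi x)%:A); last first.
  by rewrite (slinZ (h := phi)) // phi1  mulr1.
rewrite -phiE -psiE (slinear_tsum (h := phi)) //.
rewrite (slinear_tsum (h := psi)) //.
apply: eq_tsum => a b; rewrite (slinZ (h := phi)) //.
by rewrite (slinZ (h := psi)) //; exact: mulrC.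
Qed.

Lemma tsum_comulM (V : lmodType K) (f : H -> H -> V) x y : bilin f ->
  tsum f (comul (antipode x * y)) = \tsum_(a, b <- comul x)
    \tsum_(c, d <- comul y) f (antipode b * c) (antipode a * d).
Proof.
move=> fb; rewrite comulM comul_antipode tsum_tsum; last first.
  exact: balanced_bilin.
rewrite tsum_tsum; last first.
  by apply: balanced_bilin; lin.
apply: eq_tsum => a b; rewrite tsum_pure; last by lin.
rewrite tsum_tsum; last exact: balanced_bilin.
by apply: eq_tsum => c d; rewrite tsum_pure.
Qed.

(* A sesquilinear form <x, y> is handled through the bilinear [B z x] with
   [z = y°], so that these conditions and their consequences involve only
   linear maps. *)
Definition right_invariant B := forall z x,
  \tsum_(a, b <- comul z) (B b x *: a) = \tsum_(a, b <- comul x) (B z a *: b).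

(** The twist [sigma] is S^2 for the pairing of an integral, and S^2 followed by M^-1 once that
    pairing is composed with an automorphism M. *)
Definition left_invariant (sigma : H -> H) B := forall z x,
  \tsum_(a, b <- comul x) (B z b *: a) =
  \tsum_(a, b <- comul z) (B a x *: sigma b).

Definition sqr_antipode (x : H) : H := antipode (antipode x).

Definition pairing phi (z x : H) : K := phi (antipode z * x).

Lemma bilin_pairing phi : slin phi -> sbilin (pairing phi).
Proof. by move=> phil; rewrite /pairing; split=> w; lin. Qed.

(** Expand the scalar phi(w) as the sum of phi(w_1) w_2 with w = S(b) x; the factor a S(b_1) that
    appears on the left collapses to a counit. *)
Lemma right_invariant_pairing phi :
  right_integral phi -> right_invariant (pairing phi).
Proof.
move=> [phil phi1 phiE] z x; rewrite /pairing.
transitivity (\tsum_(a, b <- comul z) \tsum_(b1, b2 <- comul b)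
   \tsum_(c, d <- comul x) (phi (antipode b2 * c) *: (a * (antipode b1 * d)))).
  apply: eq_tsum => a b; rewrite -[X in _ *: X]mulr1 scalerAr -phiE.
  rewrite (linear_tsum (h := GRing.mul a)); last lin.
  rewrite tsum_comulM; last by lin.
  by apply: eq_tsum => b1 b2; apply: eq_tsum => c d; rewrite -!scalerAr.
rewrite -(coassoc (g := fun a b1 b2 => \tsum_(c, d <- comul x)
  (phi (antipode b2 * c) *: (a * (antipode b1 * d))))); last lin.
rewrite -[RHS](@counit_l _ _ _ (fun z => \tsum_(c, d <- comul x)
  (phi (antipode z * c) *: d))); last lin.
apply: eq_tsum => a b; rewrite exchange_tsum.
rewrite (linear_tsum (h := fun y => counit a *: y)); last lin.
apply: eq_tsum => c d; rewrite scalerA mulrC -scalerA.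
rewrite -[in RHS](mul1r d) scalerAl -antipoder.
rewrite (linear_tsum (h := fun y => phi (antipode b * c) *: (y * d))); last lin.
by apply: eq_tsum => a1 a2; rewrite mulrA.
Qed.

Lemma conv_sqr_antipode x :
  \tsum_(a, b <- comul x) (sqr_antipode b * antipode a) = (counit x)%:A.
Proof.
rewrite -counit_antipode -antipodel comul_antipode tsum_tsum; last first.
  by apply: balanced_bilin; lin.
by apply: eq_tsum => a b; rewrite tsum_pure //; lin.
Qed.

(** Now phi(w) is expanded as the sum of phi(w_2) w_1 with w = S(a) x, and the factor to be
    cancelled is S(a_2). Its partner on the left must be S^2(b), which is where the twist
    originates. *)
Lemma left_invariant_pairing phi :
  left_integral phi -> left_invariant sqr_antipode (pairing phi).
Proof.
move=> [phil phi1 phiE] z x; rewrite /pairing; symmetry.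
transitivity (\tsum_(a, b <- comul z) \tsum_(a1, a2 <- comul a)
   \tsum_(c, d <- comul x)
   (phi (antipode a1 * d) *: (sqr_antipode b * (antipode a2 * c)))).
  apply: eq_tsum => a b; rewrite -[X in _ *: X]mulr1 scalerAr -phiE.
  rewrite (linear_tsum (h := GRing.mul (sqr_antipode b))); last lin.
  rewrite tsum_comulM; last by lin.
  by apply: eq_tsum => b1 b2; apply: eq_tsum => c d; rewrite -!scalerAr.
have sl : lin sqr_antipode by rewrite /sqr_antipode; lin.
rewrite (coassoc (g := fun a1 a2 b => \tsum_(c, d <- comul x)
  (phi (antipode a1 * d) *: (sqr_antipode b * (antipode a2 * c)))));
  last lin.
rewrite -[RHS](@counit_r _ _ _ (fun z => \tsum_(c, d <- comul x)
  (phi (antipode z * d) *: c))); last lin.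
apply: eq_tsum => a b; rewrite exchange_tsum.
rewrite (linear_tsum (h := fun y => counit b *: y)); last lin.
apply: eq_tsum => c d; rewrite scalerA mulrC -scalerA.
rewrite -[in RHS](mul1r c) scalerAl -conv_sqr_antipode.
rewrite (linear_tsum (h := fun y => phi (antipode a * d) *: (y * c))); last lin.
by apply: eq_tsum => b1 b2; rewrite mulrA.
Qed.

End Integral.

Lemma scale_tsum (K : fieldType) (U V W : lmodType K) (f : U -> V -> K) t
    (w : W) :
  tsum f t *: w = \tsum_(x, y <- t) (f x y *: w).
Proof. exact: scaler_suml. Qed.

(** * Convolution operators: left and right ones commute, and each kind is closed under
    composition *)

Section ScalarSweedler.
Variables (K : fieldType) (A : coalgType K).
Implicit Types theta kappa : A -> K.

Lemma scoassoc (g : A -> A -> A -> K) x : @trilin _ _ _ _ K^o g ->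
  \tsum_(a, b <- comul x) \tsum_(a1, a2 <- comul a) g a1 a2 b =
  \tsum_(a, b <- comul x) \tsum_(b1, b2 <- comul b) g a b1 b2.
Proof. exact: (@coassoc _ _ K^o). Qed.

Definition convl (theta : A -> K) (z : A) : A :=
  \tsum_(a, b <- comul z) (theta a *: b).

Definition convr (theta : A -> K) (z : A) : A :=
  \tsum_(a, b <- comul z) (theta b *: a).

Lemma lin_convl theta : slin theta -> lin (convl theta).
Proof. by move=> tl; rewrite /convl; lin. Qed.

Lemma lin_convr theta : slin theta -> lin (convr theta).
Proof. by move=> tl; rewrite /convr; lin. Qed.

Lemma comul_convr theta z : slin theta ->
  comul (convr theta z) = \tsum_(a, b <- comul z) (a ⊗ convr theta b).
Proof.
move=> tl; rewrite /convr (linear_tsum (h := comul)); last lin.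
transitivity (\tsum_(a, b <- comul z) \tsum_(a1, a2 <- comul a)
    (theta b *: (a1 ⊗ a2))).
  apply: eq_tsum => a b; rewrite linearZ /= -{1}[comul a]tsum_id.
  by rewrite (linear_tsum (h := fun t => theta b *: t)); last lin.
rewrite (coassoc (g := fun a1 a2 b => theta b *: (a1 ⊗ a2))); last lin.
apply: eq_tsum => a b; rewrite (linear_tsum (h := fun t => a ⊗ t)); last lin.
by apply: eq_tsum => b1 b2; rewrite tensZr.
Qed.

Lemma comul_convl theta z : slin theta ->
  comul (convl theta z) = \tsum_(a, b <- comul z) (convl theta a ⊗ b).
Proof.
move=> tl; rewrite /convl (linear_tsum (h := comul)); last lin.
transitivity (\tsum_(a, b <- comul z) \tsum_(b1, b2 <- comul b)
    (theta a *: (b1 ⊗ b2))).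
  apply: eq_tsum => a b; rewrite linearZ /= -{1}[comul b]tsum_id.
  by rewrite (linear_tsum (h := fun t => theta a *: t)); last lin.
rewrite -(coassoc (g := fun a b1 b2 => theta a *: (b1 ⊗ b2))); last lin.
apply: eq_tsum => a b; rewrite (linear_tsum (h := fun t => t ⊗ b)); last lin.
by apply: eq_tsum => b1 b2; rewrite tensZl.
Qed.

Lemma convl_convr theta kappa z : slin theta -> slin kappa ->
  convl theta (convr kappa z) = convr kappa (convl theta z).
Proof.
move=> tl kl; have kL := lin_convr kl.
rewrite {1}/convl comul_convr // tsum_tsum; last first.
  by apply: balanced_bilin; lin.
rewrite [in RHS]/convl (linear_tsum (h := convr kappa)) //.
apply: eq_tsum => a b; rewrite tsum_pure; last lin.
by rewrite linZ.
Qed.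

Lemma convl_convl (g h : A -> K) x : slin g -> slin h ->
  convl g (convl h x) = convl (fun y => g (convl h y)) x.
Proof.
move=> gl hl; have hL := lin_convl hl.
rewrite {1}/convl comul_convl // tsum_tsum; last first.
  by apply: balanced_bilin; lin.
by apply: eq_tsum => a b; rewrite tsum_pure //; lin.
Qed.

Lemma convr_convr (g h : A -> K) x : slin g -> slin h ->
  convr g (convr h x) = convr (fun y => g (convr h y)) x.
Proof.
move=> gl hl; have hL := lin_convr hl.
rewrite {1}/convr comul_convr // tsum_tsum; last first.
  by apply: balanced_bilin; lin.
by apply: eq_tsum => a b; rewrite tsum_pure //; lin.
Qed.

End ScalarSweedler.

(** * Convolution of bilinear forms *)

Section FormConvolution.
Variables (K : fieldType) (H : hopfAlgType K).
Implicit Types (phi kappa : H -> K) (B : H -> H -> K).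

(** The legs of [z] are crossed because z = y° and ° flips [comul]: in terms of y this is the tensor
    product of the two sesquilinear forms at Δ x and Δ y. *)
Definition conv B1 B2 z x : K :=
  \tsum_(a, b <- comul z) \tsum_(c, d <- comul x) (B1 b c * B2 a d).

Lemma bilin_conv B1 B2 : sbilin B1 -> sbilin B2 -> sbilin (conv B1 B2).
Proof. by move=> b1 b2; rewrite /conv; lin. Qed.

Lemma right_invariant_conv B1 B2 : sbilin B1 -> sbilin B2 ->
  right_invariant B2 -> right_invariant (conv B1 B2).
Proof.
move=> b1 b2 B2i z x; rewrite /conv.
transitivity (\tsum_(a, b <- comul z) \tsum_(b1, b2 <- comul b)
   \tsum_(c, d <- comul x) ((B1 b2 c * B2 b1 d) *: a)).
  apply: eq_tsum => a b; rewrite scale_tsum; apply: eq_tsum => b1' b2'.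
  by rewrite scale_tsum.
rewrite -(coassoc (g := fun a b1 b2 =>
   \tsum_(c, d <- comul x) ((B1 b2 c * B2 b1 d) *: a))); last lin.
transitivity (\tsum_(a, b <- comul z) \tsum_(c, d <- comul x)
   \tsum_(c1, c2 <- comul c) ((B1 b c1 * B2 a c2) *: d)); last first.
  rewrite exchange_tsum; apply: eq_tsum => c d.
  by rewrite scale_tsum; apply: eq_tsum => a b; rewrite scale_tsum.
apply: eq_tsum => a b.
rewrite (coassoc (g := fun c1 c2 d => (B1 b c1 * B2 a c2) *: d)); last lin.
rewrite exchange_tsum; apply: eq_tsum => c d.
transitivity (B1 b c *: \tsum_(a1, a2 <- comul a) (B2 a2 d *: a1)).
  rewrite (linear_tsum (h := fun y => B1 b c *: y)); last lin.
  by apply: eq_tsum => a1 a2; rewrite scalerA.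
rewrite B2i (linear_tsum (h := fun y => B1 b c *: y)); last lin.
by apply: eq_tsum => a1 a2; rewrite scalerA.
Qed.

Lemma left_invariant_conv sigma B1 B2 : sbilin B1 -> sbilin B2 -> lin sigma ->
  left_invariant sigma B1 -> left_invariant sigma (conv B1 B2).
Proof.
move=> b1 b2 sl B1i z x; rewrite /conv; symmetry.
transitivity (\tsum_(a, b <- comul z) \tsum_(a1, a2 <- comul a)
   \tsum_(c, d <- comul x) ((B1 a2 c * B2 a1 d) *: sigma b)).
  apply: eq_tsum => a b; rewrite scale_tsum; apply: eq_tsum => b1' b2'.
  by rewrite scale_tsum.
rewrite (coassoc (g := fun a1 a2 b =>
   \tsum_(c, d <- comul x) ((B1 a2 c * B2 a1 d) *: sigma b))); last lin.
transitivity (\tsum_(a, b <- comul z) \tsum_(c, d <- comul x)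
   \tsum_(d1, d2 <- comul d) ((B1 b d1 * B2 a d2) *: c)); last first.
  rewrite exchange_tsum; apply: eq_tsum => c d.
  by rewrite scale_tsum; apply: eq_tsum => a b; rewrite scale_tsum.
apply: eq_tsum => a b.
rewrite -(coassoc (g := fun c d1 d2 => (B1 b d1 * B2 a d2) *: c)); last lin.
rewrite exchange_tsum; apply: eq_tsum => c d.
transitivity (B2 a d *: \tsum_(a1, a2 <- comul b) (B1 a1 c *: sigma a2)).
  rewrite (linear_tsum (h := fun y => B2 a d *: y)); last lin.
  by apply: eq_tsum => a1 a2; rewrite scalerA mulrC.
rewrite -B1i (linear_tsum (h := fun y => B2 a d *: y)); last lin.
by apply: eq_tsum => a1 a2; rewrite scalerA mulrC.
Qed.

Definition conv_trace B w : K := \tsum_(a, b <- comul w) B a b.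

Definition conv_twisted_trace sigma B w : K :=
  \tsum_(a, b <- comul w) B b (sigma a).

(** Right invariance of [B1] moves the legs of [x] onto [z]; then [B2] sees only legs of [z] and
    contracts to a functional. *)
Lemma conv_convl B1 B2 z x : sbilin B1 -> sbilin B2 -> right_invariant B1 ->
  conv B1 B2 z x = B1 (convl (conv_trace B2) z) x.
Proof.
move=> b1 b2 B1i; rewrite /conv.
transitivity (\tsum_(a, b <- comul z) \tsum_(b1, b2 <- comul b)
    (B1 b2 x * B2 a b1)).
  apply: eq_tsum => a b.
  transitivity (B2 a (\tsum_(c, d <- comul x) (B1 b c *: d))).
    rewrite (slinear_tsum (h := B2 a)); last lin.
    by apply: eq_tsum => c d; rewrite (slinZ (h := B2 a)) //; lin.
  rewrite -B1i (slinear_tsum (h := B2 a)); last lin.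
  by apply: eq_tsum => c d; rewrite (slinZ (h := B2 a)) //; lin.
rewrite -(scoassoc (g := fun a b1 b2 => B1 b2 x * B2 a b1)); last lin.
rewrite /convl (slinear_tsum (h := fun y => B1 y x)); last lin.
apply: eq_tsum => a b; rewrite (slinZ (h := fun y => B1 y x)); last lin.
by rewrite mulrC /conv_trace /tsum mulr_sumr.
Qed.

(** Mirror image: left invariance of [B2] moves the legs of [x] onto [z], and [B1] contracts to a
    functional that involves the twist. *)
Lemma conv_convr sigma B1 B2 z x : sbilin B1 -> sbilin B2 -> lin sigma ->
  left_invariant sigma B2 ->
  conv B1 B2 z x = B2 (convr (conv_twisted_trace sigma B1) z) x.
Proof.
move=> b1 b2 sl B2i; rewrite /conv.
transitivity (\tsum_(a, b <- comul z) \tsum_(a1, a2 <- comul a)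
    (B2 a1 x * B1 b (sigma a2))).
  apply: eq_tsum => a b.
  transitivity (B1 b (\tsum_(c, d <- comul x) (B2 a d *: c))).
    rewrite (slinear_tsum (h := B1 b)); last lin.
    by apply: eq_tsum => c d; rewrite (slinZ (h := B1 b)) 1?mulrC //; lin.
  rewrite B2i (slinear_tsum (h := B1 b)); last lin.
  by apply: eq_tsum => c d; rewrite (slinZ (h := B1 b)) //; lin.
rewrite (scoassoc (g := fun a1 a2 b => B2 a1 x * B1 b (sigma a2))); last lin.
rewrite /convr (slinear_tsum (h := fun y => B2 y x)); last lin.
apply: eq_tsum => a b; rewrite (slinZ (h := fun y => B2 y x)); last lin.
by rewrite mulrC /conv_twisted_trace /tsum mulr_sumr.
Qed.

(** The trace of the pairing is phi applied to the sum of S(a) b, hence the counit; so the pairing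
    is neutral on the right. *)
Lemma conv_pairing_r phi B z x : slin phi -> phi 1 = 1 -> sbilin B ->
  right_invariant B -> conv B (pairing phi) z x = B z x.
Proof.
move=> pl p1 bb Bi; have pb := bilin_pairing pl.
rewrite conv_convl //.
transitivity (B (convl counit z) x); last by rewrite /convl counitl.
congr (B _ x); apply: eq_tsum => a b; congr (_ *: _).
rewrite -[RHS]mulr1 -p1 -(slinZ _ _ pl) -antipodel (slinear_tsum _ _ pl).
by [].
Qed.

Lemma conv_antipode_sqr (x : H) :
  \tsum_(a, b <- comul x) (antipode b * sqr_antipode a) = (counit x)%:A.
Proof.
rewrite -counit_antipode -antipoder comul_antipode tsum_tsum; last first.
  by apply: balanced_bilin; lin.
by apply: eq_tsum => a b; rewrite tsum_pure //; lin.
Qed.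

(** Here the twisted trace is phi applied to the sum of S(b) S^2(a), again the counit, precisely
    because the twist is S^2. *)
Lemma conv_pairing_l phi B z x : slin phi -> phi 1 = 1 -> sbilin B ->
  left_invariant (@sqr_antipode _ H) B -> conv (pairing phi) B z x = B z x.
Proof.
move=> pl p1 bb Bi; have pb := bilin_pairing pl.
have sl : lin (@sqr_antipode K H) by rewrite /sqr_antipode; lin.
rewrite (conv_convr _ _ _ _ sl) //.
transitivity (B (convr counit z) x); last by rewrite /convr counitr.
congr (B _ x); apply: eq_tsum => a b; congr (_ *: _).
rewrite -[RHS]mulr1 -p1 -(slinZ _ _ pl) -conv_antipode_sqr.
by rewrite (slinear_tsum _ _ pl).
Qed.

Lemma conv_comul_convr kappa B1 B2 z x :
  sbilin B1 -> sbilin B2 -> slin kappa ->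
  conv B1 B2 (convr kappa z) x = conv (fun z => B1 (convr kappa z)) B2 z x.
Proof.
move=> b1 b2 kl; rewrite /conv comul_convr // tsum_tsum; last first.
  by apply: (@balanced_bilin _ _ _ K^o); lin.
apply: eq_tsum => a b; rewrite tsum_tens //.
by apply: (@balanced_bilin _ _ _ K^o); lin.
Qed.

End FormConvolution.

(** * Locally finite operators and inner products *)

Section FiniteSpan.
Variables (C : numClosedFieldType) (V : lmodType C).
Implicit Types (T : V -> V) (b : seq V) (x : V) (a : C).

Definition in_span b x :=
  exists c : nat -> C, x = \sum_(i < size b) c i *: b`_i.

Lemma span_dependent b m (u : 'I_m -> V) : (size b < m)%N ->
  (forall k, in_span b (u k)) ->
  exists c : 'I_m -> C, (exists k, c k != 0) /\ \sum_k c k *: u k = 0.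
Proof.
move=> bm /choice[F uE].
pose A := \matrix_(k < m, i < size b) F k i.
have : kermx A != 0.
  by rewrite -mxrank_eq0 mxrank_ker subn_eq0 -ltnNge
    (leq_ltn_trans (rank_leq_col A)).
case/rowV0Pn => c /sub_kermxP cA c0; exists (c 0); split.
  by have /rV0Pn[k ck] := c0; exists k.
transitivity (\sum_(i < size b) (c *m A) 0 i *: b`_i); last first.
  by rewrite cA big1 // => i _; rewrite mxE scale0r.
under [RHS]eq_bigr => i _ do rewrite mxE scaler_suml.
rewrite exchange_big; apply: eq_bigr => k _ /=.
by rewrite uE scaler_sumr; apply: eq_bigr => i _; rewrite mxE scalerA.
Qed.

Definition loc_finite T := forall x, exists b, forall n, in_span b (iter n T x).

Definition poly_op T (p : {poly C}) x := \sum_(i < size p) p`_i *: iter i T x.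

Lemma poly_opE T (p : {poly C}) x n : (size p <= n)%N ->
  poly_op T p x = \sum_(i < n) p`_i *: iter i T x.
Proof.
move=> pn; rewrite /poly_op (big_ord_widen n (fun i => p`_i *: iter i T x)) //.
rewrite [LHS]big_mkcond; apply: eq_bigr => i _; case: ifPn => //.
by rewrite -leqNgt => pi; rewrite nth_default // scale0r.
Qed.

Lemma poly_opZ T (p : {poly C}) a x : poly_op T (a *: p) x = a *: poly_op T p x.
Proof.
rewrite (poly_opE _ _ (size_scale_leq a p)) scaler_sumr.
by apply: eq_bigr => i _; rewrite coefZ scalerA.
Qed.

Lemma lin_iter T n : lin T -> lin (iter n T).
Proof. by move=> Tl; elim: n => [|n IH] a u v //=; rewrite IH Tl. Qed.

Lemma lin_poly_op T (p : {poly C}) : lin T -> lin (poly_op T p).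
Proof.
move=> Tl; apply: lin_bigsum => i; have il := lin_iter i Tl.
by lin.
Qed.

Lemma poly_op_XsubC T (p : {poly C}) a x : lin T ->
  poly_op T (('X - a%:P) * p) x = poly_op T p (T x - a *: x).
Proof.
move=> Tl; rewrite [RHS](linB (f := poly_op T p)); last exact: lin_poly_op.
rewrite linZ; last exact: lin_poly_op.
have sp : (size ('X * p)%R <= (size p).+1)%N.
  rewrite mulrC; apply: leq_trans (size_polyMleq _ _) _.
  by rewrite size_polyX addnC.
have sm : (size (('X - a%:P) * p)%R <= (size p).+1)%N.
  rewrite mulrC; apply: leq_trans (size_polyMleq _ _) _.
  by rewrite size_XsubC addnC.
rewrite (poly_opE _ _ sm) [X in _ - a *: X](poly_opE _ _ (leqnSn _)).
rewrite scaler_sumr; under eq_bigr => i _ do rewrite mulrBl coefB coefCM scalerBl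
  -scalerA.
rewrite big_split /= sumrN; congr (_ - _).
rewrite big_ord_recl coefXM eqxx scale0r add0r.
apply: eq_bigr => i _; rewrite coefXM /=; congr (_ *: _).
by rewrite -iterS iterSr.
Qed.

Lemma poly_op_roots T s x : lin T ->
  poly_op T (\prod_(a <- s) ('X - a%:P)) x =
  foldl (fun y a => T y - a *: y) x s.
Proof.
move=> Tl; elim: s x => [|a s IH] x.
  by rewrite big_nil /poly_op size_poly1 big_ord1 coef1 scale1r.
by rewrite big_cons poly_op_XsubC // IH.
Qed.

(** A dependence among the iterates of x gives an annihilating polynomial, which splits over an
    algebraically closed field. The [foldl] applies its linear factors one after the other, so that
    later inductions peel off one root at a time. *)
Lemma loc_finite_roots T : lin T -> loc_finite T -> forall x,
  exists s : seq C, foldl (fun y a => T y - a *: y) x s = 0.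
Proof.
move=> Tl Tf x; have [b bP] := Tf x.
have [||c [[k ck] cE]] := @span_dependent b (size b).+1 (fun k => iter k T x).
- by [].
- by move=> k; exact: bP.
pose p := \poly_(i < (size b).+1) c (inord i).
have p0 : p != 0.
  apply: contraNneq ck => p0; have := coef_poly (size b).+1 (c \o inord) k.
  by rewrite -/p p0 coef0 ltn_ord /= inord_val => <-.
have [s pE] := closed_field_poly_normal p; exists s.
have : poly_op T p x = 0.
  rewrite (poly_opE _ _ (size_poly _ _)) -[RHS]cE; apply: eq_bigr => i _.
  by rewrite coef_poly ltn_ord inord_val.
rewrite pE poly_opZ poly_op_roots //.
move/eqP; rewrite scaler_eq0 lead_coef_eq0 (negPf p0) /=.
by move/eqP.
Qed.

(** Induction on the roots. If T w = T x - a x with a nonzero, then x = T (a^-1 (x - w)). The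
    subspace [D] is carried along so that the preimage can be found inside it. *)
Lemma loc_finite_surj T (D : V -> Prop) : lin T -> loc_finite T -> injective T ->
  (forall a x y, D x -> D y -> D (a *: x + y)) -> D 0 ->
  (forall x, D x -> D (T x)) ->
  forall x, D x -> exists2 w, D w & T w = x.
Proof.
move=> Tl Tf Ti Dl D0 DT x; have [s] := loc_finite_roots Tl Tf x.
elim: s x => [|a s IH] x /= xE Dx; first by exists 0; rewrite ?lin0.
have [a0|a0] := eqVneq a 0.
  (* A zero root contributes a factor T that commutes with the others, and injectivity cancels
     it. *)
  apply: IH => //; apply: Ti; rewrite lin0 //.
  move: xE; rewrite a0 scale0r subr0 => <-.
  elim: s x {Dx} => [|c s IHs] x //=.
  by rewrite IHs linB // linZ.
have [w Dw wE] : exists2 w, D w & T w = T x - a *: x.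
  by apply: IH => //; rewrite addrC -scaleNr; apply: Dl => //; exact: DT.
exists (a^-1 *: (x - w)).
  rewrite -[_ *: _]addr0; apply: (Dl) => //; rewrite addrC -scaleN1r.
  exact: Dl.
by rewrite linZ // linB // wE opprB addrC subrK scalerA mulVf // scale1r.
Qed.

Definition eigenpairs T (s : seq (C * V)) :=
  forall p, p \in s -> T p.2 = p.1 *: p.2.

Lemma interpolation (s : seq C) (g : C -> C) :
  exists q : {poly C}, forall a, a \in s -> q.[a] = g a.
Proof.
elim: s => [|a s [q qE]]; first by exists 0.
have [as_|as_] := boolP (a \in s).
  by exists q => c; rewrite inE => /orP[/eqP->|/qE//]; exact: qE.
pose r := \prod_(c <- s) ('X - c%:P).
have ra : r.[a] != 0 by rewrite -[_ == _]/(root r a) root_prod_XsubC.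
exists (q + ((g a - q.[a]) / r.[a]) *: r) => c; rewrite inE hornerD hornerZ.
case/orP => [/eqP->|cs]; first by rewrite mulfVK // subrKC.
have /eqP-> : root r c by rewrite root_prod_XsubC.
by rewrite mulr0 addr0 qE.
Qed.

Lemma iter_eigen T a x n : lin T -> T x = a *: x -> iter n T x = a ^+ n *: x.
Proof.
move=> Tl xE; elim: n => [|n IH]; first by rewrite scale1r.
by rewrite iterS IH linZ // xE scalerA exprSr.
Qed.

Lemma poly_op_eigen T a x (p : {poly C}) : lin T -> T x = a *: x ->
  poly_op T p x = p.[a] *: x.
Proof.
move=> Tl xE; rewrite horner_coef scaler_suml.
by apply: eq_bigr => i _; rewrite (iter_eigen _ Tl xE) scalerA.
Qed.

(** This stands in for the independence of eigenspaces: if the polynomial q interpolates g on the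
    eigenvalues that occur, the second sum is q(T) of the first. *)
Lemma eigenpairs_sum0 T s (g : C -> C) : lin T -> eigenpairs T s ->
  \sum_(p <- s) p.2 = 0 -> \sum_(p <- s) g p.1 *: p.2 = 0.
Proof.
move=> Tl sT s0; have [q qE] := interpolation (map fst s) g.
have ql := lin_poly_op q Tl.
transitivity (poly_op T q (\sum_(p <- s) p.2)); last by rewrite s0 (lin0 ql).
rewrite (lin_sum (f := poly_op T q)) // !big_seq.
apply: eq_bigr => p ps; rewrite (poly_op_eigen _ Tl (sT _ ps)) qE //.
exact: map_f.
Qed.

(** The list may repeat eigenvalues and contain zero vectors; [eigenpairs_sum_eq] makes its choice
    immaterial. *)
Definition pos_diag T := forall x, exists s,
  (forall p, p \in s -> 0 < p.1) /\ eigenpairs T s /\ x = \sum_(p <- s) p.2.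

Lemma eigenpairs_sum_eq T s t (g : C -> C) : lin T -> eigenpairs T s ->
  eigenpairs T t -> \sum_(p <- s) p.2 = \sum_(p <- t) p.2 ->
  \sum_(p <- s) g p.1 *: p.2 = \sum_(p <- t) g p.1 *: p.2.
Proof.
move=> Tl sT tT st.
have := @eigenpairs_sum0 T (s ++ [seq (p.1, - p.2) | p <- t]) g Tl.
rewrite !big_cat !big_map /= sumrN st subrr => H.
apply/eqP; rewrite -subr_eq0 -sumrN; apply/eqP.
under [X in _ + X]eq_bigr => p _ do rewrite -scalerN.
apply: H => // p; rewrite mem_cat => /orP[/sT//|/mapP[q qt ->]] /=.
by rewrite linN // tT // scalerN.
Qed.

End FiniteSpan.

(** * Inner products on spaces of arbitrary dimension: diagonalisation and orthogonal projection *)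

Section InnerProduct.
Variables (C : numClosedFieldType) (V : lmodType C) (ip : V -> V -> C).

Definition inner_product := [/\ forall y, slin (ip^~ y),
  forall x y, ip y x = (ip x y)^* & forall x, x != 0 -> 0 < ip x x].

Hypothesis ipP : inner_product.

Lemma ip_lin y : slin (ip^~ y). Proof. by case: ipP. Qed.
Lemma ipC x y : ip y x = (ip x y)^*. Proof. by case: ipP. Qed.
Lemma ip_gt0 x : x != 0 -> 0 < ip x x. Proof. by case: ipP => _ _; exact. Qed.

Lemma ipDl x y z : ip (x + y) z = ip x z + ip y z.
Proof. by have /= := linD x y (ip_lin z). Qed.
Lemma ipZl a x y : ip (a *: x) y = a * ip x y.
Proof. by have /= := linZ a x (ip_lin y). Qed.
Lemma ip0l y : ip 0 y = 0.
Proof. by have /= := lin0 (ip_lin y). Qed.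
Lemma ipNl x y : ip (- x) y = - ip x y.
Proof. by have /= := linN x (ip_lin y). Qed.
Lemma ip_suml I (r : seq I) (F : I -> V) y :
  ip (\sum_(i <- r) F i) y = \sum_(i <- r) ip (F i) y.
Proof. by have /= := lin_sum r predT F (ip_lin y). Qed.
Lemma ipDr x y z : ip z (x + y) = ip z x + ip z y.
Proof. by rewrite ipC ipDl rmorphD /= -!ipC. Qed.
Lemma ipZr a x y : ip y (a *: x) = a^* * ip y x.
Proof. by rewrite ipC ipZl rmorphM /= -ipC. Qed.
Lemma ip_sumr I (r : seq I) (F : I -> V) y :
  ip y (\sum_(i <- r) F i) = \sum_(i <- r) ip y (F i).
Proof.
by rewrite ipC ip_suml rmorph_sum; apply: eq_bigr => i _; rewrite /= -ipC.
Qed.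

Lemma ip_eq0 x : (ip x x == 0) = (x == 0).
Proof.
have [->|x0] := eqVneq x 0; first by rewrite ip0l eqxx.
by rewrite gt_eqF // ip_gt0.
Qed.

Lemma ip_ge0 x : 0 <= ip x x.
Proof. by have [->|/ip_gt0/ltW//] := eqVneq x 0; rewrite ip0l. Qed.

Lemma ip_inj x y : (forall z, ip x z = ip y z) -> x = y.
Proof.
move=> xy; apply/eqP; rewrite -subr_eq0 -ip_eq0 ipDl ipNl xy.
by rewrite subrr.
Qed.

Lemma selfadjoint_pos_diag T : lin T -> loc_finite T ->
  (forall x y, ip (T x) y = ip x (T y)) ->
  (forall x, x != 0 -> 0 < ip (T x) x) -> pos_diag T.
Proof.
move=> Tl Tf Ts Tp x; have [r] := loc_finite_roots Tl Tf x.
elim: r x => [|a r IH] x /=.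
  by move=> ->; exists [::]; rewrite big_nil.
case/IH => s [s0 [sT sE]].
(* Off the eigenvalue a the operator T - a is inverted termwise, which gives x'. The remainder z = x
   - x' then satisfies (T - a) z = w with w in the eigenspace of a. *)
pose x' := \sum_(p <- s | p.1 != a) (p.1 - a)^-1 *: p.2.
pose w := \sum_(p <- s | p.1 == a) p.2.
pose z := x - x'.
have x'E : T x' - a *: x' = \sum_(p <- s | p.1 != a) p.2.
  rewrite /x' (lin_sum (f := T)) // scaler_sumr -sumrB.
  rewrite big_seq_cond [RHS]big_seq_cond.
  apply: eq_bigr => p /andP[ps pa]; rewrite linZ // sT // !scalerA -scalerBl.
  by rewrite mulrC -mulrBl mulfV ?scale1r // subr_eq0.
have zE : T z - a *: z = w.
  have -> : T z - a *: z = (T x - a *: x) - (T x' - a *: x').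
    by rewrite linB // scalerBr !opprD addrACA.
  by rewrite sE (bigID (fun p => p.1 == a)) /= -/w x'E addrK.
have wE : T w = a *: w.
  rewrite (lin_sum (f := T)) // scaler_sumr big_seq_cond [RHS]big_seq_cond.
  by apply: eq_bigr => p /andP[ps /eqP pa]; rewrite sT // pa.
(* There is no Jordan block: for real a, <w, w> = <(T - a) z, w> = <z, (T - a) w> = 0. If a is not
   positive, the sum defining w is empty. *)
have w0 : w = 0.
  have [a0|a0] := boolP (0 < a).
    apply/eqP; rewrite -ip_eq0 -{1}zE ipDl ipNl ipZl Ts wE ipZr.
    by rewrite geC0_conj ?ltW // subrr.
  rewrite /w big_seq_cond big1 // => p /andP[/s0 p0 /eqP pa].
  by move: a0; rewrite -pa p0.
have zE' : T z = a *: z by apply/eqP; rewrite -subr_eq0 zE w0.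
have xE : x = z + x' by rewrite subrK.
pose s' := [seq (p.1, (p.1 - a)^-1 *: p.2) | p <- s & p.1 != a].
have s'0 p : p \in s' -> 0 < p.1.
  by case/mapP => q; rewrite mem_filter => /andP[_ /s0 q0] ->.
have s'T : eigenpairs T s'.
  move=> p /mapP[q]; rewrite mem_filter => /andP[_ /sT qE] -> /=.
  by rewrite linZ // qE !scalerA mulrC.
have s'E : x' = \sum_(p <- s') p.2 by rewrite big_map big_filter.
have [z0|z0] := eqVneq z 0.
  by exists s'; split=> //; split=> //; rewrite xE z0 add0r.
have a0 : 0 < a.
  by have := Tp _ z0; rewrite zE' ipZl pmulr_lgt0 // ip_gt0.
exists ((a, z) :: s'); split; [|split].
- by move=> p; rewrite inE => /orP[/eqP->|/s'0].
- by move=> p; rewrite inE => /orP[/eqP->|/s'T].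
- by rewrite big_cons /= -s'E.
Qed.

Fixpoint orthoseq (e : seq V) : Prop :=
  if e is u :: e' then
    [/\ u != 0, forall v, v \in e' -> ip u v = 0 & orthoseq e']
  else True.

Definition proj (e : seq V) x := \sum_(v <- e) (ip x v / ip v v) *: v.

Lemma lin_proj e : lin (proj e).
Proof.
apply: lin_bigsum => v a x y.
by rewrite ipDl ipZl mulrDl scalerDl -mulrA scalerA.
Qed.

Lemma ip_proj e x v : orthoseq e -> v \in e -> ip (proj e x) v = ip x v.
Proof.
rewrite /proj; elim: e => //= u e IH [u0 ue eo].
rewrite big_cons ipDl ipZl inE => /orP[/eqP->|ve].
  rewrite mulfVK ?ip_eq0 // ip_suml big_seq big1 ?addr0 // => w we.
  by rewrite ipZl (ipC u w) ue // rmorph0 mulr0.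
by rewrite (ue _ ve) mulr0 add0r IH.
Qed.

Lemma orthoseq_nth e i j : orthoseq e -> (i < size e)%N -> (j < size e)%N ->
  i != j -> ip e`_i e`_j = 0.
Proof.
elim: e i j => //= u e IH [|i] [|j] [u0 ue eo] //= ie je ij.
- by rewrite ue // mem_nth.
- by rewrite ipC ue ?rmorph0 // mem_nth.
- exact: IH.
Qed.

Lemma orthoseq_neq0 e v : orthoseq e -> v \in e -> v != 0.
Proof. by elim: e => //= u e IH [u0 _ eo]; rewrite inE => /orP[/eqP->|/IH->]. Qed.

Lemma orthoseq_size e b : orthoseq e -> (forall v, v \in e -> in_span b v) ->
  (size e <= size b)%N.
Proof.
move=> eo eb; rewrite leqNgt; apply/negP => be.
have [k|c [[j cj] cE]] := span_dependent (u := fun k : 'I_(size e) => e`_k) be.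
  exact/eb/mem_nth.
case/negP: cj; have : ip (\sum_k c k *: e`_k) e`_j = 0 by rewrite cE ip0l.
rewrite ip_suml (bigD1 j) //= big1.
  move/eqP; rewrite addr0 ipZl mulf_eq0 ip_eq0 => /orP[//|].
  by rewrite (negPf (orthoseq_neq0 eo _)) // mem_nth.
by move=> i ij; rewrite ipZl orthoseq_nth ?mulr0.
Qed.

Definition linear_subspace (D : V -> Prop) :=
  D 0 /\ forall (a : C) x y, D x -> D y -> D (a *: x + y).

Lemma linear_subspaceB D x y : linear_subspace D -> D x -> D y -> D (x - y).
Proof. by move=> [_ Dl] Dx Dy; rewrite addrC -scaleN1r; exact: Dl. Qed.

Lemma linear_subspace_proj D e x : linear_subspace D ->
  (forall v, v \in e -> D v) -> D (proj e x).
Proof.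
move=> [D0 Dl]; rewrite /proj; elim: e => [|u e IH] De.
  by rewrite big_nil.
rewrite big_cons; apply: Dl; first by apply: De; rewrite mem_head.
by apply: IH => v ve; apply: De; rewrite inE ve orbT.
Qed.

(** Gram-Schmidt, where a vector of [D] not fixed by the projection contributes its residue. The
    counter [n] bounds the room left by [orthoseq_size]. *)
Lemma orthoseq_basis b (D : V -> Prop) : linear_subspace D ->
  (forall x, D x -> in_span b x) ->
  exists e, [/\ orthoseq e, forall v, v \in e -> D v &
    forall x, D x -> proj e x = x].
Proof.
move=> Ds Db.
suff ext : forall n e, (size b - size e <= n)%N -> orthoseq e ->
    (forall v, v \in e -> D v) -> exists e, [/\ orthoseq e,
    forall v, v \in e -> D v & forall x, D x -> proj e x = x].
  by apply: (ext (size b) [::]) => //; rewrite subn0.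
elim=> [|n IH] e be eo eD.
all: have [[x]|nex] := pselect (exists x, D x /\ proj e x != x).
all: try by exists e; split=> // x Dx; apply/eqP; apply: contra_notT nex => ex;
  exists x.
all: case=> Dx ex; pose e' := (x - proj e x) :: e.
all: have e'o : orthoseq e'.
1,3: split=> // [|v ve]; first by rewrite subr_eq0 eq_sym.
1,2: by rewrite ipDl ipNl ip_proj // subrr.
all: have e'D v : v \in e' -> D v.
1,3: rewrite inE => /orP[/eqP->|/eD//]; apply: linear_subspaceB => //.
1,2: exact: linear_subspace_proj.
all: have := orthoseq_size e'o (fun v ve => Db v (e'D v ve)) => /= e's.
  by move: be; rewrite leqn0 subn_eq0 leqNgt e's.
by apply: (IH e') => //=; rewrite subnS -ltnS prednK ?subn_gt0.
Qed.

End InnerProduct.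

(** * Tensor products of inner product spaces *)

Section TensorForm.
Variables (C : numClosedFieldType) (U V : lmodType C).
Variables (f : U -> U -> C) (h : V -> V -> C).
Hypotheses (fP : inner_product f) (hP : inner_product h).

(** Gram-Schmidt on the first legs, with the coefficients moved to the second legs, which stay
    arbitrary and may vanish. *)
Lemma tensor_ortho_decomp (t : (U ⊗ V)%type) : exists s : seq (U * V),
  orthoseq f [seq p.1 | p <- s] /\ t = \sum_(p <- s) p.1 ⊗ p.2.
Proof.
rewrite -[t]tensor_of_repr tensor_ofE; elim: (repr t) => [|[a b] r [s [so sE]]].
  by exists [::]; rewrite !big_nil.
pose e := [seq p.1 | p <- s].
pose s' := [seq (p.1, p.2 + (f a p.1 / f p.1 p.1) *: b) | p <- s].
have s'e : [seq p.1 | p <- s'] = e by rewrite -map_comp; exact: eq_map.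
have s'E : \sum_(p <- s') p.1 ⊗ p.2 =
    proj f e a ⊗ b + \sum_(p <- s) p.1 ⊗ p.2.
  rewrite /proj (lin_sum (f := fun y => y ⊗ b)); last lin.
  rewrite !big_map -big_split; apply: eq_bigr => p _ /=.
  by rewrite tensDr tensZr tensZl addrC.
rewrite big_cons sE /=.
have [a0|a0] := eqVneq (a - proj f e a) 0.
  exists s'; rewrite s'e s'E; split=> //; congr (_ ⊗ _ + _).
  by apply/eqP; rewrite -subr_eq0 a0.
exists ((a - proj f e a, b) :: s'); rewrite /= s'e; split.
  by split=> // v ve; rewrite ipDl // ipNl // ip_proj // subrr.
by rewrite big_cons s'E addrA -tensDl subrK.
Qed.

Definition tensor_form (s t : (U ⊗ V)%type) : C :=
  \tsum_(a, b <- s) \tsum_(c, d <- t) (f a c * h b d).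

Lemma balanced_tensor_formr a b : balanced (fun c d => f a c * h b d).
Proof.
split=> [v v' w|v w w'|k v w].
- by rewrite ipDr // mulrDl.
- by rewrite ipDr // mulrDr.
- by rewrite !ipZr // mulrCA mulrA.
Qed.

Lemma bilin_tensor_forml (t : (U ⊗ V)%type) :
  @bilin C U V C^o (fun a b => \tsum_(c, d <- t) (f a c * h b d)).
Proof.
have fl := ip_lin fP; have hl := ip_lin hP.
split=> w; apply: (@lin_tsum _ _ _ C^o) => c d; [exact: slin_mull|].
exact: slin_mulr.
Qed.

Lemma tensor_form_sum (s t : seq (U * V)) :
  tensor_form (\sum_(p <- s) p.1 ⊗ p.2) (\sum_(p <- t) p.1 ⊗ p.2) =
  \sum_(p <- s) \sum_(q <- t) f p.1 q.1 * h p.2 q.2.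
Proof.
rewrite -!tensor_ofE /tensor_form tsum_tensor_of; last first.
  exact: (@balanced_bilin _ _ _ C^o) (bilin_tensor_forml _).
apply: eq_bigr => p _; rewrite tsum_tensor_of //.
exact: balanced_tensor_formr.
Qed.

(** Orthogonal first legs leave only the diagonal terms f(p_1, p_1) h(p_2, p_2), all nonnegative. *)
Lemma tensor_form_gt0 t : t != 0 -> 0 < tensor_form t t.
Proof.
have [s [so tE]] := tensor_ortho_decomp t.
have -> : tensor_form t t = \sum_(p <- s) f p.1 p.1 * h p.2 p.2.
  rewrite tE tensor_form_sum {t tE}.
  elim: s so => [|p s IH] /=; first by rewrite !big_nil.
  case=> p0 ps so; rewrite !big_cons -[X in _ = _ + X]IH //.
  rewrite -addrA; congr (_ + _).
  rewrite [X in X + _]big_seq big1 ?add0r; last first.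
    by move=> q qs; rewrite ps ?mul0r //; exact: map_f.
  rewrite !big_seq; apply: eq_bigr => q qs; rewrite big_cons.
  by rewrite (ipC fP) ps ?rmorph0 ?mul0r ?add0r //; exact: map_f.
move=> t0; rewrite lt_def; apply/andP; split; last first.
  by apply: sumr_ge0 => p _; rewrite mulr_ge0 // ip_ge0.
apply: contra t0; rewrite psumr_eq0; last first.
  by move=> p _; rewrite mulr_ge0 // ip_ge0.
move=> /allP s0; rewrite tE big_seq big1 // => p ps.
have := s0 _ ps; rewrite /= mulf_eq0 !ip_eq0 //.
rewrite (negPf (orthoseq_neq0 so _)) ?map_f //= => /eqP->.
by rewrite -[0](scale0r 0) tensZr scale0r.
Qed.

(** Test with g = h(-, p_2), then pair with p_1: orthogonality isolates the term h(p_2, p_2) f(p_1,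
    p_1). *)
Lemma tensor_separation (t : (U ⊗ V)%type) :
  (forall g : V -> C, slin g -> \tsum_(a, b <- t) (g b *: a) = 0) -> t = 0.
Proof.
have [s [so ->]] := tensor_ortho_decomp t => t0.
rewrite big_seq big1 // => p ps; suff -> : p.2 = 0.
  by rewrite -[0](scale0r 0) tensZr scale0r.
have hl := ip_lin hP p.2; apply/eqP; rewrite -(ip_eq0 hP).
have /(congr1 (f^~ p.1)) := t0 _ hl; rewrite ip0l //.
rewrite -tensor_ofE tsum_tensor_of; last first.
  by apply: balanced_bilin; lin.
rewrite ip_suml // => E; apply/eqP.
have : h p.2 p.2 * f p.1 p.1 = 0.
  move: E; elim: s so ps {t0} => //= q s IH [q0 qs so].
  rewrite inE big_cons ipZl // => /orP[/eqP->|ps].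
    rewrite [X in _ + X]big_seq big1 ?addr0 // => r rs.
    by rewrite ipZl // (ipC fP) qs ?rmorph0 ?mulr0 //; exact: map_f.
  by rewrite qs ?mulr0 ?add0r ?map_f //; exact: IH.
move/eqP; rewrite mulf_eq0 => /orP[/eqP//|].
by rewrite ip_eq0 // (negPf (orthoseq_neq0 so _)) // map_f.
Qed.

End TensorForm.

(** * The inner product of a compact quantum group *)

(** A fresh name for [A], so that the comodule structure given by [comul] is attached to the copy.
    Compactness enters through this comodule. *)
Definition regular_comodule (K : fieldType) (A : coalgType K) : Type := A.

Section RegularComodule.
Variables (K : fieldType) (A : coalgType K).

HB.instance Definition _ := GRing.Lmodule.on (regular_comodule A).
HB.instance Definition _ := Lmodule_isComodule.Build K A (regular_comodule A)
  (@comulA K A) (@counitr K A).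

End RegularComodule.

Section LocallyFinite.
Variables (C : numClosedFieldType) (A : coalgType C).

Lemma convl_iter (kappa : A -> C) n x : slin kappa ->
  exists2 theta : A -> C, slin theta & iter n (convl kappa) x = convl theta x.
Proof.
move=> kl; have kL := lin_convl kl; elim: n => [|n [theta tl tE]].
  by exists counit; [exact: slin_counit|rewrite /convl counitl].
have tL := lin_convl tl; exists (fun x => kappa (convl theta x)); first lin.
by rewrite iterS tE convl_convl.
Qed.

Lemma convr_iter (kappa : A -> C) n x : slin kappa ->
  exists2 theta : A -> C, slin theta & iter n (convr kappa) x = convr theta x.
Proof.
move=> kl; have kL := lin_convr kl; elim: n => [|n [theta tl tE]].
  by exists counit; [exact: slin_counit|rewrite /convr counitr].
have tL := lin_convr tl; exists (fun x => kappa (convr theta x)); first lin.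
by rewrite iterS tE convr_convr.
Qed.

Lemma in_span_sum (V : lmodType C) I (r : seq I) (F : I -> V) (c : I -> C) :
  in_span [seq F i | i <- r] (\sum_(i <- r) c i *: F i).
Proof.
case: r => [|i0 r]; first by exists (fun=> 0); rewrite big_nil big_ord0.
exists (fun k => c (nth i0 (i0 :: r) k)).
rewrite (big_nth i0) big_mkord size_map; apply: eq_bigr => k _.
by rewrite (nth_map i0).
Qed.

Lemma in_span_convl theta (x : A) :
  in_span [seq p.2 | p <- repr (comul x)] (convl theta x).
Proof. exact: (in_span_sum (repr (comul x)) snd (fun p => theta p.1)). Qed.

Lemma in_span_convr theta (x : A) :
  in_span [seq p.1 | p <- repr (comul x)] (convr theta x).
Proof. exact: (in_span_sum (repr (comul x)) fst (fun p => theta p.2)). Qed.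

(** Iterates of a convolution are convolutions, and all convolutions of x lie in the span of the
    legs of one representative of Δ x. *)
Lemma loc_finite_convl (kappa : A -> C) :
  slin kappa -> loc_finite (convl kappa).
Proof.
move=> kl x; exists [seq p.2 | p <- repr (comul x)] => n.
by have [theta _ ->] := convl_iter n x kl; exact: in_span_convl.
Qed.

Lemma loc_finite_convr (kappa : A -> C) :
  slin kappa -> loc_finite (convr kappa).
Proof.
move=> kl x; exists [seq p.1 | p <- repr (comul x)] => n.
by have [theta _ ->] := convr_iter n x kl; exact: in_span_convr.
Qed.

End LocallyFinite.

Section HaarInnerProduct.
Variables (R : realType) (H : hopfAlgType R[i]) (circ : H -> H).
Hypothesis circH : circ_Hopf circ.
Implicit Types B : H -> H -> R[i].

Definition form_of B x y := B (circ y) x.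

Lemma tensor_formC (C : numClosedFieldType) (U V : lmodType C)
    (f : U -> U -> C) (h : V -> V -> C) s t :
  inner_product f -> inner_product h ->
  tensor_form f h t s = (tensor_form f h s t)^*.
Proof.
move=> fP hP; rewrite /tensor_form exchange_tsum /tsum rmorph_sum /=.
apply: eq_bigr => p _; rewrite rmorph_sum /=; apply: eq_bigr => q _.
by rewrite rmorphM /= -(ipC fP) -(ipC hP).
Qed.

Lemma conv_form_of B1 B2 x y : sbilin B1 -> sbilin B2 ->
  form_of (conv B1 B2) x y =
  tensor_form (form_of B1) (form_of B2) (comul x) (comul y).
Proof.
move=> b1 b2; rewrite /form_of /conv (tsum_comul_circ circH) //; last first.
  by apply: (@balanced_bilin _ _ _ R[i]^o); lin.
by rewrite exchange_tsum.
Qed.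

(** Positivity passes from the tensor product to H because the counit makes [comul] injective. *)
Lemma inner_product_conv B1 B2 : sbilin B1 -> sbilin B2 ->
  inner_product (form_of B1) -> inner_product (form_of B2) ->
  inner_product (form_of (conv B1 B2)).
Proof.
move=> b1 b2 p1 p2; have bc := bilin_conv b1 b2; split.
- by move=> y; rewrite /form_of; lin.
- by move=> x y; rewrite !conv_form_of // tensor_formC.
move=> x x0; rewrite conv_form_of //; apply: tensor_form_gt0 => //.
apply: contraNneq x0 => cx0; rewrite -(counitl x) cx0.
by rewrite (lin0 (f := tsum _)) //; lin.
Qed.

Variable f : H -> H -> R[i].
Hypothesis fP : inner_product f.
Hypothesis f_unitary : forall u v,
  \tsum_(u0, u1 <- comul u) (f u0 v *: u1) =
  \tsum_(v0, v1 <- comul v) (f u v0 *: circ v1).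

Definition uform (z x : H) : R[i] := f x (circ z).

Lemma bilin_uform : sbilin uform.
Proof.
split=> [x|z] a u v; last by rewrite /uform (ip_lin fP).
by rewrite /uform (circD circH) // (circZ circH) // ipDr // ipZr // conjCK.
Qed.

Lemma right_invariant_uform : right_invariant uform.
Proof.
move=> z x; rewrite /uform f_unitary (tsum_comul_circ circH) //.
  by apply: eq_tsum => a b; rewrite circK.
split=> [v v' w|v w w'|a v w].
- by rewrite ipDr // scalerDl.
- by rewrite (circD circH) // scalerDr.
- by rewrite ipZr // (circZ circH) // scalerA mulrC.
Qed.

Lemma one_neq0 : (1 : H) != 0.
Proof.
apply/eqP => /(congr1 counit); rewrite counit1 linear0.
by apply/eqP; exact: oner_neq0.
Qed.

Definition haar (x : H) : R[i] := f x 1 / f 1 1.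

Lemma slin_haar : slin haar.
Proof. by rewrite /haar; apply: slin_mull; exact: ip_lin. Qed.

Lemma haar1 : haar 1 = 1.
Proof. by rewrite /haar mulfV // gt_eqF // ip_gt0 // one_neq0. Qed.

(** This is right invariance of [uform] at z = 1, where Δ 1 = 1 ⊗ 1. *)
Lemma right_integral_haar : right_integral haar.
Proof.
split; [exact: slin_haar|exact: haar1|move=> x].
have fl := bilin_uform.
have := right_invariant_uform 1 x; rewrite comul1 tsum_pure; last lin.
rewrite /uform (circ1 circH) // => E.
rewrite /haar mulrC -scalerA E (linear_tsum (h := fun y => _ *: y)); last lin.
by apply: eq_tsum => a b; rewrite scalerA mulrC.
Qed.

(** The involution exchanges the two legs, hence the two kinds of integral. Uniqueness then
    identifies this functional with [haar], which becomes two-sided. *)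
Lemma left_integral_haar_circ : left_integral (fun x => (haar (circ x))^*).
Proof.
have [hl h1 hE] := right_integral_haar.
split=> [a u v||x]; rewrite ?(circ1 circH) // ?haar1 ?rmorph1 //.
  by rewrite (circD circH) // (circZ circH) // hl rmorphD rmorphM /= conjCK.
rewrite -[RHS](circK circH) (circZ circH) // (circ1 circH) // conjCK -hE.
rewrite (tsum_comul_circ circH) //; last by apply: balanced_bilin; lin.
rewrite (circ_tsum circH); apply: eq_tsum => a b.
by rewrite (circZ circH) (circK circH).
Qed.

Lemma haar_circ x : haar (circ x) = (haar x)^*.
Proof.
rewrite (integral_uniq right_integral_haar left_integral_haar_circ).
by rewrite (circK circH).
Qed.

Lemma left_integral_haar : left_integral haar.
Proof.
have [_ _ hE] := left_integral_haar_circ.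
split=> [||x]; [exact: slin_haar|exact: haar1|].
have hc y : (haar (circ y))^* = haar y by rewrite haar_circ conjCK.
by rewrite -hc -hE; apply: eq_tsum => a b; rewrite hc.
Qed.

Local Notation T := (circ_antipode circ).

Definition twisted_uform (z x : H) : R[i] := uform (antipode z) (T x).

Lemma bilin_twisted_uform : sbilin twisted_uform.
Proof.
have ub := bilin_uform; have Tl := lin_circ_antipode circH.
by rewrite /twisted_uform; lin.
Qed.

Lemma form_of_twisted_uform x y : form_of twisted_uform x y = f (T x) (T y).
Proof. by []. Qed.

(** [T] reverses [comul], so right invariance of [uform] becomes left invariance. Applying the
    antipode returns the legs of T x to those of x and turns those of S z into S^2. *)
Lemma left_invariant_twisted_uform :
  left_invariant (@sqr_antipode _ H) twisted_uform.
Proof.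
have ub := bilin_uform; have Tl := lin_circ_antipode circH.
move=> z x; rewrite /twisted_uform.
transitivity (antipode (\tsum_(a, b <- comul (T x))
    (uform (antipode z) a *: b))).
  rewrite (comul_circ_antipode circH) // tsum_tsum; last first.
    by apply: balanced_bilin; lin.
  rewrite (linear_tsum (h := antipode)); last lin.
  apply: eq_tsum => a b; rewrite tsum_pure; last lin.
  by rewrite linearZ /= (antipode_circ_antipode circH).
rewrite -right_invariant_uform comul_antipode tsum_tsum; last first.
  by apply: balanced_bilin; lin.
rewrite (linear_tsum (h := antipode)); last lin.
apply: eq_tsum => a b; rewrite tsum_pure; last lin.
by rewrite linearZ.
Qed.

Lemma inner_product_uform : inner_product (form_of uform).
Proof.
case: fP => f1 f2 f3.
split=> [y|x y|x]; rewrite /form_of /uform !(circK circH) //.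
exact: f3.
Qed.

Lemma inner_product_twisted_uform : inner_product (form_of twisted_uform).
Proof.
have Tl := lin_circ_antipode circH.
split=> [y a u v|x y|x x0]; rewrite !form_of_twisted_uform.
- by rewrite Tl ipDl // ipZl.
- exact: ipC.
apply: ip_gt0 => //; apply: contraNneq x0 => Tx0.
by rewrite -(antipode_circ_antipode circH x) Tx0 linear0.
Qed.

(** The order matters: a convolution inherits left invariance from its first factor and right
    invariance from its second. *)
Definition biform := conv twisted_uform uform.

Lemma bilin_biform : sbilin biform.
Proof. exact: bilin_conv bilin_twisted_uform bilin_uform. Qed.

Lemma right_invariant_biform : right_invariant biform.
Proof.
exact: right_invariant_conv bilin_twisted_uform bilin_uform
  right_invariant_uform.
Qed.

Lemma left_invariant_biform : left_invariant (@sqr_antipode _ H) biform.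
Proof.
apply: left_invariant_conv bilin_twisted_uform bilin_uform _
  left_invariant_twisted_uform.
by rewrite /sqr_antipode; lin.
Qed.

Lemma inner_product_biform : inner_product (form_of biform).
Proof.
exact: inner_product_conv bilin_twisted_uform bilin_uform
  inner_product_twisted_uform inner_product_uform.
Qed.

Local Notation beta := (pairing haar).

Definition biform_op : H -> H :=
  convr (conv_twisted_trace (@sqr_antipode _ H) biform).

Lemma slin_biform_trace : slin (conv_twisted_trace (@sqr_antipode _ H) biform).
Proof.
have bb := bilin_biform; rewrite /conv_twisted_trace /sqr_antipode; lin.
Qed.

(** Two evaluations of [conv biform beta]: by left invariance of [beta], and by neutrality of [beta]
    on the right. *)
Lemma pairing_biform_op z x : beta (biform_op z) x = biform z x.
Proof.
have bb := bilin_biform; have pb := bilin_pairing slin_haar.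
have sl : lin (@sqr_antipode _ H) by rewrite /sqr_antipode; lin.
rewrite -(conv_convr z x bb pb sl); last first.
  exact/left_invariant_pairing/left_integral_haar.
exact: conv_pairing_r slin_haar haar1 bb right_invariant_biform.
Qed.

(** Insert [beta] as a left neutral factor; the operator then acts on the leg paired by [beta],
    where [pairing_biform_op] absorbs it. *)
Lemma biform_biform_op z x : biform (biform_op z) x = conv biform biform z x.
Proof.
have bb := bilin_biform; have pb := bilin_pairing slin_haar.
rewrite -(conv_pairing_l _ _ slin_haar haar1 bb left_invariant_biform).
rewrite conv_comul_convr //; last exact: slin_biform_trace.
rewrite /conv; apply: eq_tsum => a b; apply: eq_tsum => c d.
by rewrite pairing_biform_op.
Qed.

Lemma biform_op_inj : injective biform_op.
Proof.
move=> z w zw; apply: (can_inj (circK circH)).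
apply: (ip_inj inner_product_biform) => x.
rewrite (ipC inner_product_biform) [RHS](ipC inner_product_biform).
by rewrite /form_of !(circK circH) // -!pairing_biform_op zw.
Qed.

Lemma biform_op_surj x : exists w, biform_op w = x.
Proof.
have kl := slin_biform_trace.
have [w _ <-] := @loc_finite_surj _ _ biform_op (fun=> True) (lin_convr kl)
  (loc_finite_convr kl) biform_op_inj (fun _ _ _ _ _ => I) I (fun _ _ => I) x I.
by exists w.
Qed.

(** Every element is (K w)° with K = [biform_op]. At (K w)° and (K z)° the form takes the value of
    the inner product [conv biform biform] at w° and z°, from which symmetry and positivity are read
    off. *)
Lemma inner_product_haar : inner_product (form_of beta).
Proof.
have bb := bilin_biform; have pb := bilin_pairing slin_haar.
have P1 := inner_product_biform; have P2 := inner_product_conv bb bb P1 P1.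
have E z w : form_of beta (circ (biform_op w)) (circ (biform_op z)) =
    form_of (conv biform biform) (circ w) (circ z).
  rewrite /form_of (circK circH) // pairing_biform_op.
  transitivity (form_of biform (circ (biform_op w)) (circ z)).
    by rewrite /form_of (circK circH).
  rewrite (ipC P1) {1}/form_of (circK circH) // biform_biform_op.
  by rewrite [RHS](ipC P2) /form_of (circK circH).
have S x : exists w, x = circ (biform_op w).
  by have [w wE] := biform_op_surj (circ x); exists w; rewrite wE (circK circH).
split=> [y|x y|x].
- by rewrite /form_of; lin.
- by have [w ->] := S x; have [z ->] := S y; rewrite !E (ipC P2).
have [w ->] := S x => x0; rewrite E; apply: ip_gt0 => //.
apply: contraNneq x0 => w0; rewrite -[w](circK circH) w0 (circ0 circH) //.
by rewrite lin0 ?(circ0 circH) //; exact: lin_convr slin_biform_trace.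
Qed.

End HaarInnerProduct.

Lemma cqg_integral (R : realType) (H : hopfAlgType R[i]) (circ : H -> H) :
  compact_quantum_group circ -> exists phi : H -> R[i],
  [/\ right_integral phi, left_integral phi &
      inner_product (form_of circ (pairing phi))].
Proof.
move=> [circH /(_ (regular_comodule H))[f fU]].
have fP : inner_product (f : H -> H -> R[i]).
  split=> [y a u v|x y|x x0].
  - by rewrite linearPl.
  - by rewrite hermC expr0 mul1r.
  - by rewrite dnorm_gt0.
exists (haar f); split.
- exact: (right_integral_haar circH).
- exact: (left_integral_haar circH).
- exact: (inner_product_haar circH).
Qed.

(** * Cosemisimplicity *)

Section SpanSubspace.
Variables (C : numClosedFieldType) (V : lmodType C).

Lemma in_span_subspace (b : seq V) : linear_subspace (in_span b).
Proof.
split; first by exists (fun=> 0); rewrite big1 // => i _; rewrite scale0r.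
move=> a x y [c ->] [d ->]; exists (fun i => a * c i + d i).
rewrite scaler_sumr -big_split; apply: eq_bigr => i _ /=.
by rewrite scalerDl scalerA.
Qed.

Lemma in_span_mem (b : seq V) v : v \in b -> in_span b v.
Proof.
move=> vb; have vi : (index v b < size b)%N by rewrite index_mem.
exists (fun i => (i == index v b)%:R); rewrite (bigD1 (Ordinal vi)) //=.
rewrite eqxx scale1r nth_index // big1 ?addr0 // => i iv.
by rewrite -[_ == _]/(i == Ordinal vi) (negPf iv) scale0r.
Qed.

End SpanSubspace.

Section Cosemisimple.
Local Open Scope classical_set_scope.
Variables (R : realType) (H : hopfAlgType R[i]) (circ : H -> H).
Hypothesis circH : circ_Hopf circ.
Variable phi : H -> R[i].
Hypothesis phir : right_integral phi.
Hypothesis phil : left_integral phi.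

Local Notation ip := (form_of circ (pairing phi)).
Hypothesis ipP : inner_product ip.

Lemma tsum_subcoalgebra (D : set H) x : subcoalgebra D -> D x ->
  exists2 s : seq (H * H), (forall p, p \in s -> D p.1 /\ D p.2) &
    forall (Z : zmodType) (f : H -> H -> Z), balanced f ->
      tsum f (comul x) = \sum_(p <- s) f p.1 p.2.
Proof.
move=> [_ Dc] /Dc [s [sD sE]]; exists s => // Z f fb.
by rewrite sE -tensor_ofE tsum_tensor_of.
Qed.

Lemma subcoalgebra_convl (D : set H) g x :
  subcoalgebra D -> slin g -> D x -> D (convl g x).
Proof.
move=> Dc gl Dx; have [s sD sE] := tsum_subcoalgebra Dc Dx.
rewrite /convl sE; last by apply: balanced_bilin; lin.
have [[D0 Dl] _] := Dc; rewrite big_seq; elim/big_ind: _ => //.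
  by move=> u v Du Dv; rewrite -[u]scale1r; exact: Dl.
by move=> p /sD[_ Dp]; rewrite -[_ *: _]addr0; exact: Dl.
Qed.

Lemma subcoalgebra_convr (D : set H) g x :
  subcoalgebra D -> slin g -> D x -> D (convr g x).
Proof.
move=> Dc gl Dx; have [s sD sE] := tsum_subcoalgebra Dc Dx.
rewrite /convr sE; last by apply: balanced_bilin; lin.
have [[D0 Dl] _] := Dc; rewrite big_seq; elim/big_ind: _ => //.
  by move=> u v Du Dv; rewrite -[u]scale1r; exact: Dl.
by move=> p /sD[Dp _]; rewrite -[_ *: _]addr0; exact: Dl.
Qed.

(* With p the orthogonal projection onto D, closure under right convolutions
   gives (p ⊗ 1)Δx = Δx, closure under left ones (1 ⊗ p)Δx = Δx. *)
Lemma subcoalgebra_of_conv (D : set H) b : subspace D ->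
  (forall x, D x -> in_span b x) ->
  (forall g x, slin g -> D x -> D (convl g x)) ->
  (forall g x, slin g -> D x -> D (convr g x)) -> subcoalgebra D.
Proof.
move=> Ds Db Dl Dr; split=> // x Dx.
have [e [eo eD eP]] := orthoseq_basis ipP Ds Db.
pose p := proj ip e; have pl : lin p := lin_proj ipP e.
have pD y : D (p y) by exact: linear_subspace_proj.
have pE1 : comul x = \tsum_(a, b <- comul x) (p a ⊗ b).
  apply/eqP; rewrite -subr_eq0 -[X in X - _]tsum_id; apply/eqP.
  transitivity (\tsum_(a, b <- comul x) ((a - p a) ⊗ b)).
    by rewrite /tsum -sumrB; apply: eq_bigr => q _; rewrite tensDl tensNl.
  apply: (tensor_separation ipP ipP) => g gl.
  rewrite tsum_tsum; last by apply: balanced_bilin; lin.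
  transitivity (convr g x - p (convr g x)); last first.
    by rewrite /p eP ?subrr //; exact: Dr.
  rewrite /convr (linear_tsum (h := p)) // -tsumB; apply: eq_tsum => u v.
  rewrite tsum_tens; last by apply: balanced_bilin; lin.
  by rewrite linZ // scalerBr.
have pE2 : \tsum_(a, b <- comul x) (p a ⊗ (b - p b)) = 0.
  transitivity (\sum_(v <- e) v ⊗ (\tsum_(a, b <- comul x)
      ((ip a v / ip v v) *: (b - p b)))).
    under [RHS]eq_bigr => v _.
      rewrite (linear_tsum (h := fun y => v ⊗ y)); last lin.
      over.
    rewrite /tsum exchange_big; apply: eq_bigr => q _.
    rewrite /p /proj (lin_sum (f := fun y => y ⊗ _)); last lin.
    by apply: eq_bigr => v _; rewrite tensZl tensZr.
  rewrite big1 // => v _; set y := tsum _ _; suff -> : y = 0.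
    by rewrite -[0](scale0r 0) tensZr scale0r.
  have gl : slin (fun a => ip a v / ip v v).
    by apply: slin_mull; exact: (ip_lin ipP).
  transitivity (convl (fun a => ip a v / ip v v) x -
    p (convl (fun a => ip a v / ip v v) x)); last first.
    by rewrite /p eP ?subrr //; exact: Dl.
  rewrite /convl (linear_tsum (h := p)) // /tsum -sumrB; apply: eq_bigr => q _.
  by rewrite linZ // scalerBr.
exists [seq (p q.1, p q.2) | q <- repr (comul x)]; split.
  by move=> q /mapP[r _ ->]; split; exact: pD.
rewrite big_map [LHS]pE1; apply/eqP; rewrite -subr_eq0 -[X in _ == X]pE2.
apply/eqP; rewrite /tsum -sumrB; apply: eq_bigr => q _ /=.
by rewrite tensDr tensNr.
Qed.

Lemma subspace_ortho (D E : set H) : subspace D ->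
  subspace (D `&` [set x | forall y, E y -> ip x y = 0]).
Proof.
move=> [D0 Dl]; split.
  by split=> //= y _; rewrite (ip0l ipP).
move=> a x y [Dx xE] [Dy yE]; split; first exact: Dl.
by move=> z Ez /=; rewrite (ipDl ipP) (ipZl ipP) xE // yE // mulr0 addr0.
Qed.

(** Invariance on either side trades a convolution of x for the legs of y, which remain in [E]; so D
    ∩ E^⊥ is closed under both kinds of convolution. *)
Lemma subcoalgebra_ortho (D E : set H) b : subcoalgebra D ->
  (forall x, D x -> in_span b x) -> subcoalgebra E ->
  subcoalgebra (D `&` [set x | forall y, E y -> ip x y = 0]).
Proof.
move=> Dc Db Ec; have [pl _ _] := phir; have pb := bilin_pairing pl.
apply: (@subcoalgebra_of_conv _ b).
- by apply: subspace_ortho; case: Dc.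
- by move=> x [/Db].
- move=> g x gl [Dx xE]; split; first exact: subcoalgebra_convl.
  move=> y Ey /=; rewrite /form_of.
  transitivity (g (\tsum_(p, q <- comul x) (pairing phi (circ y) q *: p))).
    rewrite /convl (slinear_tsum (h := pairing phi (circ y))); last lin.
    rewrite (slinear_tsum (h := g)) //; apply: eq_tsum => p q.
    by rewrite (slinZ _ _ gl) (slinZ (h := pairing phi (circ y))) 1?mulrC //; lin.
  have sl : lin (@sqr_antipode _ H) by rewrite /sqr_antipode; lin.
  rewrite (left_invariant_pairing phil) (tsum_comul_circ circH); last first.
    by apply: balanced_bilin; lin.
  have [s sE ->] := tsum_subcoalgebra Ec Ey.
    rewrite big_seq big1 ?(lin0 (f := g : _ -> _^o)) // => p /sE[_ /xE].
    by rewrite /form_of => ->; rewrite scale0r.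
  split=> [v v' w|v w w'|a v w].
  - by rewrite (circD circH) (linD _ _ sl) scalerDr.
  - by rewrite (circD circH) (linD _ _ (proj1 pb _)) scalerDl.
  - rewrite !(circZ circH) (linZ _ _ sl) (linZ _ _ (proj1 pb _)).
    by rewrite scalerA mulrC.
- move=> g x gl [Dx xE]; split; first exact: subcoalgebra_convr.
  move=> y Ey /=; rewrite /form_of.
  transitivity (g (\tsum_(p, q <- comul x) (pairing phi (circ y) p *: q))).
    rewrite /convr (slinear_tsum (h := pairing phi (circ y))); last lin.
    rewrite (slinear_tsum (h := g)) //; apply: eq_tsum => p q.
    by rewrite (slinZ _ _ gl) (slinZ (h := pairing phi (circ y))) 1?mulrC //; lin.
  rewrite -(right_invariant_pairing phir) (tsum_comul_circ circH); last first.
    by apply: balanced_bilin; lin.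
  have [s sE ->] := tsum_subcoalgebra Ec Ey.
    rewrite big_seq big1 ?(lin0 (f := g : _ -> _^o)) // => p /sE[/xE].
    by rewrite /form_of => ->; rewrite scale0r.
  split=> [v v' w|v w w'|a v w].
  - by rewrite (circD circH) (linD _ _ (proj1 pb _)) scalerDl.
  - by rewrite (circD circH) scalerDr.
  - rewrite !(circZ circH) (linZ _ _ (proj1 pb _)).
    by rewrite scalerA mulrC.
Qed.

(** A strict subcoalgebra [E] splits [D] as [E] plus its orthogonal complement [F]. The number [n],
    a strict bound on the length of orthogonal families, plays the part of the dimension. *)
Lemma simple_decomposition b n (D : set H) : subcoalgebra D ->
  (forall x, D x -> in_span b x) ->
  (forall e, orthoseq ip e -> (forall v, v \in e -> D v) -> (size e < n)%N) ->
  forall x, D x -> exists s : seq H,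
    (forall y, y \in s -> exists E, simple_subcoalgebra E /\ E y) /\
  x = \sum_(y <- s) y.
Proof.
elim: n D => [|n IH] D Dc Db Dn x Dx.
  by have : (size ([::] : seq H) < 0)%N by exact: Dn.
have [Ds|nDs] := pselect (simple_subcoalgebra D).
  exists [:: x]; split; last by rewrite big_seq1.
  by move=> y; rewrite inE => /eqP->; exists D.
have [D0|nD0] := pselect (D = [set 0]).
  by exists [::]; split=> //; rewrite big_nil; move: Dx; rewrite D0.
have [E [Ec ED nE0 nED]] : exists E, [/\ subcoalgebra E, E `<=` D,
    E <> [set 0] & E <> D].
  apply: contra_notP nDs => nE; split=> // E Ec ED.
  apply: contra_notP nE => /not_orP[nE0 nED].
  by exists E.
pose F : set H := D `&` [set x | forall y, E y -> ip x y = 0].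
have Fc : subcoalgebra F := subcoalgebra_ortho Dc Db Ec.
have Ds := proj1 Dc; have Es := proj1 Ec.
have [e [eo eE eP]] := orthoseq_basis ipP Es (fun y Ey => Db y (ED y Ey)).
have FD y : D y -> F (y - proj ip e y).
  have pE : E (proj ip e y) by exact: linear_subspace_proj.
  move=> Dy; split; first by apply: linear_subspaceB => //; exact: ED.
  move=> z Ez /=; rewrite -(eP z Ez) /proj (ip_sumr ipP) big_seq big1 // => v ve.
  by rewrite (ipZr ipP) (ipDl ipP) (ipNl ipP) (ip_proj ipP) // subrr mulr0.
have nz (G : set H) : subcoalgebra G -> G <> [set 0] -> exists2 z, G z & z != 0.
  move=> [[G0 _] _] Gn; apply: contra_notP Gn => nz; apply/seteqP; split=> y /=.
    by move=> Gy; apply: contra_notP nz => /eqP y0; exists y.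
  by move=> ->.
have [z Ez z0] := nz _ Ec nE0.
have [w Fw w0] : exists2 w, F w & w != 0.
  apply: contra_notP nED => nw; apply/seteqP; split=> // y Dy.
  have /eqP : y - proj ip e y = 0.
    apply: contra_notP nw => /eqP yw; exists (y - proj ip e y) => //.
    exact: FD.
  by rewrite subr_eq0 => /eqP->; exact: linear_subspace_proj.
have [sE [sE1 sE2]] : exists s : seq H,
    (forall y, y \in s -> exists E, simple_subcoalgebra E /\ E y) /\
    proj ip e x = \sum_(y <- s) y.
  apply: (IH E) => //; [by move=> y /ED/Db| |exact: linear_subspace_proj].
  (* A nonzero vector of the complement extends any orthogonal family in [E], so the bound drops by
     one; [z] does the same for [F] below. *)
  move=> r ro rE; have := Dn (w :: r); apply.
    split=> // v /rE Ev; have [_ wE] := Fw; exact: wE.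
  by move=> v; rewrite inE => /orP[/eqP->|/rE/ED//]; case: Fw.
have [sF [sF1 sF2]] : exists s : seq H,
    (forall y, y \in s -> exists E, simple_subcoalgebra E /\ E y) /\
    x - proj ip e x = \sum_(y <- s) y.
  apply: (IH F) => //; [by move=> y [/Db]| |exact: FD].
  move=> r ro rF; have := Dn (z :: r); apply.
    split=> // v /rF[_ vE]; rewrite (ipC ipP) vE // rmorph0 //.
  by move=> v; rewrite inE => /orP[/eqP->|/rF[]//]; exact: ED.
exists (sE ++ sF); split.
  by move=> y; rewrite mem_cat => /orP[/sE1|/sF1].
by rewrite big_cat /= -sE2 -sF2 addrC subrK.
Qed.

(** The span of all two-sided convolutions of x, which is a subcoalgebra containing x. Writing it as
    an intersection of subspaces makes membership an induction principle. *)
Definition generated_coideal (x : H) : set H := [set y |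
  forall E : H -> Prop, linear_subspace E ->
    (forall g h, slin g -> slin h -> E (convl g (convr h x))) -> E y].

Lemma generated_coideal_subspace x : subspace (generated_coideal x).
Proof.
split=> [E [E0 _] _|a y z Dy Dz E Es Eg] //.
by have [_ El] := Es; apply: El; [exact: Dy|exact: Dz].
Qed.

Lemma generated_coideal_span x : exists b, forall y,
  generated_coideal x y -> in_span b y.
Proof.
(* These are the middle legs of the iterated coproduct of x. *)
exists (flatten [seq [seq q.2 | q <- repr (comul p.1)] | p <- repr (comul x)]).
move=> y; apply; first exact: in_span_subspace.
move=> g h gl hl; have gL := lin_convl gl.
rewrite {1}/convr (linear_tsum (h := convl g)) // /tsum big_seq.
have Ss := in_span_subspace (flatten
  [seq [seq q.2 | q <- repr (comul p.1)] | p <- repr (comul x)]).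
elim/big_ind: _ => [|u v|p px]; first by case: Ss.
  by move=> Su Sv; rewrite -[u]scale1r; case: Ss => _; exact.
rewrite linZ // /convl /tsum scaler_sumr big_seq.
elim/big_ind: _ => [|u v|q qp]; first by case: Ss.
  by move=> Su Sv; rewrite -[u]scale1r; case: Ss => _; exact.
rewrite scalerA -[_ *: _]addr0; case: (Ss) => S0 Sl; apply: Sl => //.
apply: in_span_mem; apply/flattenP.
exists [seq q.2 | q <- repr (comul p.1)]; last exact: map_f.
by apply/mapP; exists p.
Qed.

Lemma subcoalgebra_generated_coideal x : subcoalgebra (generated_coideal x).
Proof.
have [b bP] := generated_coideal_span x.
apply: (@subcoalgebra_of_conv _ b) => //.
- exact: generated_coideal_subspace.
- move=> g y gl Dy E [E0 El] Eg; have gL := lin_convl gl.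
  apply: (Dy (fun y => E (convl g y))) => [|g' h g'l hl].
    split; first by rewrite lin0.
    by move=> a u v Eu Ev; rewrite gL; exact: El.
  by rewrite convl_convl //; apply: Eg => //; have := lin_convl g'l; lin.
- move=> g y gl Dy E [E0 El] Eg; have gL := lin_convr gl.
  apply: (Dy (fun y => E (convr g y))) => [|g' h g'l hl].
    split; first by rewrite lin0.
    by move=> a u v Eu Ev; rewrite gL; exact: El.
  rewrite -convl_convr // convr_convr //; apply: Eg => //.
  by have := lin_convr hl; lin.
Qed.

Lemma generated_coideal_id x : generated_coideal x x.
Proof.
move=> E _ /(_ counit counit); rewrite /convl /convr counitr counitl; apply.
  exact: slin_counit.
exact: slin_counit.
Qed.

Lemma cosemisimple x : exists s : seq H,
  (forall y, y \in s -> exists E, simple_subcoalgebra E /\ E y) /\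
  x = \sum_(y <- s) y.
Proof.
have [b bP] := generated_coideal_span x.
apply: (@simple_decomposition b (size b).+1 (generated_coideal x)) => //.
- exact: subcoalgebra_generated_coideal.
- by move=> e eo eD; rewrite ltnS; apply: (orthoseq_size ipP) => // v /eD/bP.
- exact: generated_coideal_id.
Qed.

Lemma subcoalgebra_scalars : subcoalgebra (@scalars _ H).
Proof.
split.
  split; first by exists 0 => //; rewrite scale0r.
  move=> a x y [c _ <-] [d _ <-]; exists (a * c + d) => //.
  by rewrite scalerDl scalerA.
move=> x [c _ <-]; exists [:: (c%:A, 1)]; split.
  move=> p; rewrite inE => /eqP->; split; first by exists c.
  by exists 1 => //; rewrite scale1r.
by rewrite big_seq1 linearZ /= comul1 tensZl.
Qed.

(** If phi(y) is nonzero for some y in a simple [D], convolving y with phi yields phi(y) 1, so [D]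
    contains the scalars and equals them by simplicity. *)
Lemma integral_other_simple x : other_simple_sum x -> phi x = 0.
Proof.
have [pl p1 pE] := phir.
move=> [s [sP ->]].
rewrite (lin_sum (f := phi : _ -> _^o)) // big_seq big1 // => y.
case/sP => D [[Dc nD0 Dmin] nDs Dy].
apply: contra_notP nDs => /eqP py0.
have D1 : D 1.
  have := subcoalgebra_convl Dc pl Dy; rewrite /convl pE => Dp.
  have [[D0 Dl] _] := Dc; have := Dl (phi y)^-1 _ _ Dp D0.
  by rewrite addr0 scalerA mulVf // scale1r.
have sD : @scalars _ H `<=` D.
  move=> _ [c _ <-]; have [[D0 Dl] _] := Dc.
  by rewrite -[_ *: _]addr0; exact: Dl.
have [s0|->//] := Dmin _ subcoalgebra_scalars sD.
have : @scalars _ H 1 by exists 1 => //; rewrite scale1r.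
by rewrite s0 /= => /eqP; rewrite (negPf (one_neq0 H)).
Qed.

(** A decomposition of x into simple summands shows that an admissible scalar exists, so [xget] does
    not return its default; applying phi shows that any such scalar is phi(x). *)
Lemma normal_integralE x : normal_integral x = phi x.
Proof.
have [pl p1 pE] := phir.
have [c cP] : exists c : R[i], other_simple_sum (x - c%:A).
  have [s [sP ->]] := cosemisimple x; elim: s sP => [|y s IH] sP.
    exists 0; rewrite big_nil scale0r subr0; exists [::]; split=> //.
    by rewrite big_nil.
  have [|c [r [rP rE]]] := IH.
    by move=> z zs; apply: sP; rewrite inE zs orbT.
  have [D [Ds Dy]] := sP y (mem_head _ _).
  have [DE|DE] := pselect (D = @scalars _ H).
    move: Dy; rewrite DE => -[d _ <-]; exists (d + c); exists r; split=> //.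
    by rewrite big_cons scalerDl opprD addrACA subrr add0r.
  exists c; exists (y :: r); split; last by rewrite !big_cons -addrA rE.
  by move=> z; rewrite inE => /orP[/eqP->|/rP//]; exists D.
rewrite /normal_integral; case: xgetP => [d _ dP|/(_ c)//].
have := integral_other_simple dP; rewrite (linB (f := phi : _ -> _^o)) //.
by rewrite (slinZ _ _ pl) p1 mulr1 => /eqP; rewrite subr_eq0 => /eqP.
Qed.

End Cosemisimple.

(** * Functional calculus *)

Lemma lrmorphism_of (K : fieldType) (A : algType K) (f : A -> A) :
  lin f -> f 1 = 1 -> {morph f : x y / x * y} ->
  exists g : {lrmorphism A -> A}, (g : A -> A) = f.
Proof.
move=> fl f1 fM.
pose fL := GRing.isLinear.Build K A A _ f fl.
pose fR := GRing.isMonoidMorphism.Build A A f (f1, fM).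
pose g : {lrmorphism A -> A} := HB.pack f fL fR.
by exists g.
Qed.

Section FunctionalCalculus.
Variables (C : numClosedFieldType) (V : lmodType C) (T : V -> V).
Hypotheses (Tl : lin T) (Td : pos_diag T).

(** Additivity alone is asked for, so that conjugate linear maps can be compared too. *)
Lemma eigen_ext (W : zmodType) (F G : V -> W) :
  {morph F : x y / x + y} -> {morph G : x y / x + y} ->
  (forall a v, 0 < a -> T v = a *: v -> F v = G v) -> F =1 G.
Proof.
move=> FD GD FG x.
have m0 (F' : V -> W) : {morph F' : x y / x + y} -> F' 0 = 0.
  by move=> FD'; apply: (addrI (F' 0)); rewrite -FD' !addr0.
have [s [s0 [sT ->]]] := Td x.
rewrite (big_morph F FD (m0 _ FD)) (big_morph G GD (m0 _ GD)) !big_seq.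
by apply: eq_bigr => p ps; apply: (FG p.1); [exact: s0|exact: sT].
Qed.

Definition fcalc (g : C -> C) (x : V) : V :=
  \sum_(p <- projT1 (cid (Td x))) g p.1 *: p.2.

Lemma fcalcE g s : eigenpairs T s ->
  fcalc g (\sum_(p <- s) p.2) = \sum_(p <- s) g p.1 *: p.2.
Proof.
move=> sT; rewrite /fcalc; case: cid => t [_ [tT tE]] /=.
exact: eigenpairs_sum_eq.
Qed.

Lemma fcalc_eigen g a v : T v = a *: v -> fcalc g v = g a *: v.
Proof.
move=> va; have := @fcalcE g [:: (a, v)]; rewrite !big_seq1; apply.
by move=> p; rewrite inE => /eqP->.
Qed.

Lemma lin_fcalc g : lin (fcalc g).
Proof.
move=> a x y; have [s [_ [sT xE]]] := Td x; have [t [_ [tT yE]]] := Td y.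
pose u := [seq (p.1, a *: p.2) | p <- s] ++ t.
have uT : eigenpairs T u.
  move=> p; rewrite mem_cat => /orP[/mapP[q qs ->]|/tT//] /=.
  by rewrite linZ // sT // !scalerA mulrC.
have -> : a *: x + y = \sum_(p <- u) p.2.
  by rewrite big_cat big_map /= -scaler_sumr -xE -yE.
rewrite [in RHS]xE [in RHS]yE !fcalcE // big_cat big_map /= scaler_sumr.
by congr (_ + _); apply: eq_bigr => p _; rewrite !scalerA mulrC.
Qed.

Lemma fcalcD g : {morph fcalc g : x y / x + y}.
Proof. by move=> x y; rewrite linD //; exact: lin_fcalc. Qed.

Lemma fcalc_comp g h x : fcalc g (fcalc h x) = fcalc (fun a => g a * h a) x.
Proof.
move: x; apply: eigen_ext => [x y|x y|a v _ va]; rewrite ?fcalcD //.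
rewrite (fcalc_eigen h va) linZ; last exact: lin_fcalc.
by rewrite !(fcalc_eigen _ va) scalerA mulrC.
Qed.

Lemma eq_fcalc g h : (forall a, 0 < a -> g a = h a) -> fcalc g =1 fcalc h.
Proof.
move=> gh; apply: eigen_ext => [x y|x y|a v a0 va]; rewrite ?fcalcD //.
by rewrite !(fcalc_eigen _ va) gh.
Qed.

Lemma fcalc_id : fcalc id =1 T.
Proof.
apply: eigen_ext => [x y|x y|a v _ va]; rewrite ?fcalcD ?linD //.
by rewrite (fcalc_eigen _ va) va.
Qed.

Lemma fcalc1 x : fcalc (fun=> 1) x = x.
Proof.
move: x; apply: eigen_ext => [x y|x y|a v _ va]; rewrite ?fcalcD //.
by rewrite (fcalc_eigen _ va) scale1r.
Qed.

(** On two eigenvectors, either the eigenvalues agree or the vectors are orthogonal. *)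
Lemma fcalc_selfadjoint (ip : V -> V -> C) g : inner_product ip ->
  (forall x y, ip (T x) y = ip x (T y)) ->
  (forall a, 0 < a -> (g a)^* = g a) ->
  forall x y, ip (fcalc g x) y = ip x (fcalc g y).
Proof.
move=> ipP Ts gr x y; move: x; apply: eigen_ext => [u v|u v|a v a0 va].
- by rewrite fcalcD ipDl.
- by rewrite ipDl.
move: y; apply: eigen_ext => [u w|u w|b w b0 wb].
- by rewrite ipDr.
- by rewrite fcalcD ipDr.
rewrite (fcalc_eigen _ va) (fcalc_eigen _ wb) ipZl // ipZr // gr //.
have := Ts v w; rewrite va wb ipZl // ipZr // (geC0_conj (ltW b0)).
have [->//|ab] := eqVneq a b => /eqP; rewrite -subr_eq0 -mulrBl mulf_eq0.
by rewrite subr_eq0 (negPf ab) => /eqP->; rewrite !mulr0.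
Qed.

End FunctionalCalculus.

(** * Functional calculus on the tensor square *)

Section TensorCalculus.
Variables (C : numClosedFieldType) (V : lmodType C) (T : V -> V).
Hypotheses (Tl : lin T) (Td : pos_diag T).

Definition tensor_map (F : V -> V) (t : (V ⊗ V)%type) : (V ⊗ V)%type :=
  \tsum_(a, b <- t) (F a ⊗ F b).

Lemma lin_tensor_map F : lin F -> lin (tensor_map F).
Proof. by move=> Fl; rewrite /tensor_map; lin. Qed.

Lemma tensor_map_pure F a b : lin F -> tensor_map F (a ⊗ b) = F a ⊗ F b.
Proof. by move=> Fl; rewrite /tensor_map tsum_pure //; lin. Qed.

Lemma pos_diag_tensor_map : pos_diag (tensor_map T).
Proof.
move=> t; rewrite -[t]tensor_of_repr tensor_ofE.
elim: (repr t) => [|[a b] r [s [s0 [sT sE]]]].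
  by exists [::]; rewrite !big_nil.
have [u [u0 [uT uE]]] := Td a; have [w [w0 [wT wE]]] := Td b.
exists ([seq (p.1 * q.1, p.2 ⊗ q.2) | p <- u, q <- w] ++ s); split; [|split].
- move=> p; rewrite mem_cat => /orP[|/s0//].
  case/allpairsP => -[p1 p2] [/= /u0 h1 /w0 h2 ->].
  exact: mulr_gt0.
- move=> p; rewrite mem_cat => /orP[/allpairsP[[p1 p2] [/= h1 h2 ->]]|/sT//].
  by rewrite tensor_map_pure // uT // wT //= tensZl tensZr scalerA.
rewrite big_cons big_cat -sE /= big_allpairs_dep /=; congr (_ + _).
rewrite [in LHS]uE (lin_sum (f := fun y => y ⊗ b)); last lin.
apply: eq_bigr => p _; rewrite [in LHS]wE (lin_sum (f := fun y => p.2 ⊗ y)) //.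
lin.
Qed.

(** Eigenvalues of T ⊗ T are products of eigenvalues of T. This prepares the compatibility of a
    multiplicative function of M with [comul]. *)
Lemma fcalc_tensor_map g t :
  (forall a b, 0 < a -> 0 < b -> g (a * b) = g a * g b) ->
  fcalc pos_diag_tensor_map g t = tensor_map (fcalc Td g) t.
Proof.
move=> gM; have Fl := lin_fcalc Tl Td g.
have TTl := lin_tensor_map Tl.
apply: tensor_ext; [exact: lin_fcalc|exact: lin_tensor_map|move=> a b].
rewrite tensor_map_pure //; move: a; apply: (eigen_ext Td) => [u v|u v|c v c0 vc].
- by rewrite tensDl (linD _ _ (lin_fcalc _ _ _)).
- by rewrite (linD _ _ Fl) tensDl.
move: b; apply: (eigen_ext Td) => [u w|u w|d w d0 wd].
- by rewrite tensDr (linD _ _ (lin_fcalc _ _ _)).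
- by rewrite (linD _ _ Fl) tensDr.
rewrite (fcalc_eigen Tl _ _ vc) (fcalc_eigen Tl _ _ wd).
rewrite (@fcalc_eigen _ _ _ TTl _ g (c * d)) ?gM //.
  by rewrite tensZl tensZr scalerA.
by rewrite tensor_map_pure // vc wd tensZl tensZr scalerA.
Qed.

End TensorCalculus.

(** * Positive automorphisms *)

Section HopfEndomorphism.
Variables (K : fieldType) (H : hopfAlgType K).

Definition bialgebra_morphism (f : H -> H) :=
  [/\ lin f, f 1 = 1, {morph f : x y / x * y} & coalgebra_morphism f].

Lemma bialgebra_antipode f : bialgebra_morphism f ->
  forall x, antipode (f x) = f (antipode x).
Proof.
move=> [fl f1 fM fc]; have [g gE] := lrmorphism_of fl f1 fM.
by rewrite -gE; apply: morphism_antipode; rewrite gE.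
Qed.

Lemma tsum_comul_morphism (V : lmodType K) (h : H -> H -> V) f x :
  bialgebra_morphism f -> bilin h ->
  tsum h (comul (f x)) = \tsum_(a, b <- comul x) h (f a) (f b).
Proof.
move=> [_ _ _ [fc _]] hb; rewrite fc tsum_tsum; last exact: balanced_bilin.
by apply: eq_tsum => a b; rewrite tsum_pure.
Qed.

Lemma right_integral_morphism phi f g : bialgebra_morphism f -> cancel f g ->
  right_integral phi -> right_integral (phi \o f).
Proof.
move=> fb fg [pl p1 pE]; have [fl f1 _ _] := fb.
split=> [||x] /=; [exact: (@lin_comp _ _ _ K^o phi f)|by rewrite f1|].
apply: (can_inj fg); rewrite linZ // f1 -pE (tsum_comul_morphism _ fb); last lin.
by rewrite (linear_tsum _ _ fl); apply: eq_tsum => a b; rewrite linZ.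
Qed.

End HopfEndomorphism.

Lemma bialgebra_circ_comp (R : realType) (H : hopfAlgType R[i])
    (circ loz : H -> H) :
  circ_Hopf circ -> circ_Hopf loz -> bialgebra_morphism (loz \o circ).
Proof.
move=> cH lH; split=> [a x y||x y|] /=.
- by rewrite (circD cH) (circZ cH) (circD lH) (circZ lH) conjCK.
- by rewrite (circ1 cH) (circ1 lH).
- by rewrite (circM cH) (circM lH).
split=> x /=; last by rewrite (counit_circ lH) (counit_circ cH) conjCK.
rewrite (comul_circ lH) (tsum_comul_circ cH) //.
split=> [v v' w|v w w'|a v w].
- by rewrite (circD lH) tensDr.
- by rewrite (circD lH) tensDl.
- by rewrite !(circZ lH) tensZl tensZr.
Qed.

Lemma bialgebra_comp (K : fieldType) (H : hopfAlgType K) (f g : H -> H) :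
  bialgebra_morphism f -> bialgebra_morphism g -> bialgebra_morphism (f \o g).
Proof.
move=> fb gb; have [fl f1 fM [fc fe]] := fb; have [gl g1 gM [gc ge]] := gb.
split=> [||x y|]; rewrite /= ?g1 //; first exact: lin_comp.
  by rewrite gM fM.
split=> x /=; last by rewrite fe ge.
rewrite fc -[LHS]/(tsum (fun a b => f a ⊗ f b) _).
by rewrite (tsum_comul_morphism _ gb) //; lin.
Qed.

Section PositiveAutomorphism.
Variables (R : realType) (H : hopfAlgType R[i]) (circ : H -> H).
Hypothesis circH : circ_Hopf circ.
Variable phi : H -> R[i].
Hypothesis phir : right_integral phi.
Hypothesis phil : left_integral phi.

Local Notation ip := (form_of circ (pairing phi)).
Hypothesis ipP : inner_product ip.

Variables M Minv : H -> H.
Hypotheses (Mb : bialgebra_morphism M) (MK : cancel M Minv)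
  (MinvK : cancel Minv M).
Hypothesis Minvl : lin Minv.
Hypothesis Ms : forall x y, ip (M x) y = ip x (M y).
Hypothesis Mp : forall x, x != 0 -> 0 < ip (M x) x.

Lemma integral_morphism x : phi (M x) = phi x.
Proof.
exact: (integral_uniq (right_integral_morphism Mb MK phir) phil).
Qed.

Let pl : slin phi. Proof. by case: phir. Qed.
Let Ml : lin M. Proof. by case: Mb. Qed.
Let pb : sbilin (pairing phi). Proof. exact: bilin_pairing. Qed.

Lemma pairing_morphism z x : pairing phi z (M x) = pairing phi (Minv z) x.
Proof.
rewrite /pairing -[RHS]integral_morphism; have [_ _ MM _] := Mb.
by rewrite MM -bialgebra_antipode // MinvK.
Qed.

Lemma pairing_inj z w : (forall x, pairing phi z x = pairing phi w x) -> z = w.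
Proof.
move=> zw; apply: (can_inj (circK circH)); apply: (ip_inj ipP) => x.
by rewrite (ipC ipP) [RHS](ipC ipP) /form_of !(circK circH) zw.
Qed.

Let beta := pairing phi.
Let betaM z x := pairing phi z (M x).

Let bM : sbilin betaM.
Proof. by rewrite /betaM; lin. Qed.

Let sigma x := Minv (sqr_antipode x).

Let sigmal : lin sigma.
Proof. by rewrite /sigma /sqr_antipode; lin. Qed.

(** Apply left invariance of the pairing at M x, then pull the resulting vector back along M^-1. *)
Lemma left_invariant_morphism : left_invariant sigma betaM.
Proof.
have sl : lin (@sqr_antipode _ H) by rewrite /sqr_antipode; lin.
move=> z x; rewrite /betaM /sigma.
transitivity (Minv (\tsum_(a, b <- comul (M x)) (pairing phi z b *: a))).
  rewrite (tsum_comul_morphism _ Mb); last lin.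
  rewrite (linear_tsum _ _ Minvl); apply: eq_tsum => a b.
  by rewrite linZ // MK.
rewrite (left_invariant_pairing phil) (linear_tsum _ _ Minvl).
by apply: eq_tsum => a b; rewrite linZ.
Qed.

(** [convl theta] is the E' of the overview and [convr kappa] its E. *)
Let theta := conv_trace betaM.
Let kappa := conv_twisted_trace sigma beta.

Let thetal : slin theta.
Proof. by rewrite /theta /conv_trace; lin. Qed.

Let kappal : slin kappa.
Proof. by rewrite /kappa /conv_twisted_trace /beta; lin. Qed.

(* Both sides represent [conv beta betaM]: the left one through right
   invariance of [beta], the right one through left invariance of [betaM]. *)
Lemma morphism_convl z : M (convl theta z) = convr kappa z.
Proof.
rewrite -[RHS]MinvK; congr M; apply: pairing_inj => x.
rewrite -pairing_morphism -/(betaM _ x).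
rewrite -(conv_convr z x pb bM sigmal left_invariant_morphism).
by rewrite (conv_convl _ _ pb bM (right_invariant_pairing phir)).
Qed.

(** The form [beta (convl theta z) x] is [conv beta betaM], an inner product because both factors
    are, hence nondegenerate. *)
Lemma convl_theta_inj : injective (convl theta).
Proof.
have P2 : inner_product (form_of circ betaM).
  split=> [y|x y|x x0]; first by rewrite /form_of; lin.
    by rewrite -[LHS]/(ip (M y) x) -[in RHS]/(ip (M x) y) Ms (ipC ipP).
  exact: Mp.
have P := inner_product_conv circH pb bM ipP P2.
move=> z w zw; apply: (can_inj (circK circH)); apply: (ip_inj P) => x.
rewrite (ipC P) [RHS](ipC P) /form_of !(circK circH).
by rewrite !(conv_convl _ _ pb bM (right_invariant_pairing phir)) zw.
Qed.

(** A subspace stable under [convl theta]; inverting the operator inside it keeps the preimages of x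
    under control. *)
Let coideal x y := exists2 g : H -> R[i], slin g & y = convl g x.

Lemma convl_theta_surj x y : coideal x y ->
  exists2 w, coideal x w & convl theta w = y.
Proof.
apply: (loc_finite_surj (lin_convl thetal) (loc_finite_convl thetal)
  convl_theta_inj (D := coideal x)).
- move=> a u v [g gl ->] [h hl ->]; exists (fun y => a * g y + h y); first lin.
  rewrite /convl (linear_tsum (h := fun y => a *: y)) /tsum; last lin.
  by rewrite -big_split; apply: eq_bigr => p _; rewrite /= scalerDl scalerA.
- exists (fun=> 0); first by move=> a u v; rewrite addr0 scaler0.
  by rewrite /convl /tsum big1 // => p _; rewrite scale0r.
- move=> u [g gl ->]; exists (fun y => theta (convl g y)).
    by have := lin_convl gl; lin.
  by rewrite convl_convl.
Qed.

Lemma coideal_id x : coideal x x.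
Proof.
by exists counit; [exact: slin_counit|rewrite /convl counitl].
Qed.

Lemma iter_convl_surj n x y : coideal x y ->
  exists2 w, coideal x w & iter n (convl theta) w = y.
Proof.
elim: n y => [|n IH] y yx; first by exists y.
have [w wx <-] := convl_theta_surj yx; have [v vx <-] := IH _ wx.
by exists v.
Qed.

(** M E' = E commutes with E', since left and right convolutions commute; surjectivity of E' lets
    this factor be cancelled. *)
Lemma morphism_convlC x : M (convl theta x) = convl theta (M x).
Proof.
have [w _ <-] := convl_theta_surj (coideal_id x).
rewrite !morphism_convl convl_convr //.
Qed.

Lemma iter_morphism n w :
  iter n M (iter n (convl theta) w) = iter n (convr kappa) w.
Proof.
elim: n => // n IH; rewrite !iterS -IH -morphism_convl; congr M.
move: (iter n (convl theta) w) => y; elim: n y {IH} => // n IH y.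
by rewrite !iterS IH morphism_convlC.
Qed.

(** If x = E'^n w with w a left convolution of x, then M^n x = E^n w is a two-sided convolution of
    x, so all iterates stay in one finite-dimensional space. *)
Lemma loc_finite_morphism : loc_finite M.
Proof.
move=> x; have [b bP] := generated_coideal_span x; exists b => n; apply: bP.
have [w [g gl wE] wx] := iter_convl_surj n (coideal_id x).
rewrite -[X in iter n M X]wx iter_morphism.
have [h hl ->] := convr_iter n w kappal.
move=> E _ Eg; rewrite wE -convl_convr //; exact: Eg.
Qed.

Lemma pos_diag_morphism : pos_diag M.
Proof. exact: (selfadjoint_pos_diag ipP Ml loc_finite_morphism Ms Mp). Qed.

End PositiveAutomorphism.

Section BialgebraCalculus.
Variables (C : numClosedFieldType) (H : hopfAlgType C) (M : H -> H).
Hypotheses (Mb : bialgebra_morphism M) (Md : pos_diag M).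
Variable g : C -> C.
Hypothesis g1 : g 1 = 1.
Hypothesis gM : forall a b, 0 < a -> 0 < b -> g (a * b) = g a * g b.

(** A product of eigenvectors is an eigenvector, or zero, for the product of the eigenvalues, so
    multiplicativity of [g] carries over. *)
Lemma fcalc_bialgebra : bialgebra_morphism (fcalc Md g).
Proof.
have [Ml M1 MM [Mc Me]] := Mb; have Fl := lin_fcalc Ml Md g; split=> //.
- by rewrite (fcalc_eigen Ml _ _ (a := 1)) ?g1 ?scale1r.
- move=> x y; move: x; apply: (eigen_ext Md) => [u v|u v|a v a0 va].
  + by rewrite mulrDl linD.
  + by rewrite linD // mulrDl.
  move: y; apply: (eigen_ext Md) => [u w|u w|b w b0 wb].
  + by rewrite mulrDr linD.
  + by rewrite linD // mulrDr.
  rewrite (fcalc_eigen Ml _ _ va) (fcalc_eigen Ml _ _ wb).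
  rewrite (fcalc_eigen Ml _ _ (a := a * b)) ?gM //.
    by rewrite -scalerAl -scalerAr scalerA.
  by rewrite MM va wb -scalerAl -scalerAr scalerA.
split.
(* [comul] intertwines M with M ⊗ M, so it sends an eigenvector of M to one of M ⊗ M for the same
   eigenvalue. *)
- move=> x; rewrite -[RHS]/(tensor_map (fcalc Md g) (comul x)).
  have TFl := lin_tensor_map Fl; move: x.
  apply: (eigen_ext Md) => [u v|u v|a v a0 va].
  + by rewrite linD // linearD.
  + by rewrite linearD linD.
  rewrite -(fcalc_tensor_map Ml) // (fcalc_eigen Ml _ _ va) linearZ /=.
  rewrite (fcalc_eigen (lin_tensor_map Ml) _ _ (a := a)) //.
  by rewrite -[LHS]Mc va linearZ.
apply: (eigen_ext Md) => [u v|u v|a v a0 va].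
- by rewrite linD // linearD.
- by rewrite linearD.
rewrite (fcalc_eigen Ml _ _ va) linearZ /=.
(* The counit is M-invariant, so it vanishes on eigenvectors whose eigenvalue is not 1. *)
have := Me v; rewrite va linearZ /= => /eqP.
rewrite -subr_eq0 -{2}[counit v]mul1r -mulrBl mulf_eq0.
case/orP => [|/eqP->]; last by rewrite mulr0.
by rewrite subr_eq0 => /eqP->; rewrite g1 mul1r.
Qed.

End BialgebraCalculus.

(** * The automorphism P and its relation to the two involutions *)

Theorem theorem7p3 (R : realType) (H : hopfAlgType R[i]) (circ loz : H -> H)
  (circ_cqg : compact_quantum_group circ) (loz_Hopf : circ_Hopf loz) :
  exists (P : {lrmorphism H -> H}) (Pinv : H -> H),
    [/\ hopf_automorphism P,
        cancel P Pinv /\ cancel Pinv P,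
        positive_operator circ P,
        loz \o (P \o circ \o Pinv) = (P \o circ \o Pinv) \o loz &
        compact_quantum_group loz -> loz = P \o circ \o Pinv].
Proof.
have cH : circ_Hopf circ by case: circ_cqg.
have cK := circK cH; have lK := circK loz_Hopf.
have [phi [phir phil ipP]] := cqg_integral circ_cqg.
set ip := form_of circ (pairing phi) in ipP.
pose L x := loz (circ x); pose Li x := circ (loz x).
have LK : cancel L Li by move=> x; rewrite /L /Li lK cK.
have LiK : cancel Li L by move=> x; rewrite /L /Li cK lK.
have Lb : bialgebra_morphism L := bialgebra_circ_comp cH loz_Hopf.
have Lib : bialgebra_morphism Li := bialgebra_circ_comp loz_Hopf cH.
have [Ll _ _ _] := Lb; have [Lil _ _ _] := Lib.
pose M x := L (L x); pose Mi x := Li (Li x).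
have Mb : bialgebra_morphism M := bialgebra_comp Lb Lb.
have Mib : bialgebra_morphism Mi := bialgebra_comp Lib Lib.
have [Ml M1 _ _] := Mb; have [Mil _ _ _] := Mib.
have MK : cancel M Mi by move=> x; rewrite /M /Mi !LK.
have MiK : cancel Mi M by move=> x; rewrite /M /Mi !LiK.
(* Moving L across the pairing gives L^-1 on y°, and L^-1 (y°) = (L y)°. *)
have Ls x y : ip (L x) y = ip x (L y).
  rewrite /ip /form_of (pairing_morphism phir phil Lb LK LiK).
  by rewrite /Li /L.
have Ms x y : ip (M x) y = ip x (M y) by rewrite /M !Ls.
have Mp x : x != 0 -> 0 < ip (M x) x.
  move=> x0; rewrite /M Ls; apply: ip_gt0 => //.
  by apply: contraNneq x0 => Lx; rewrite -(LK x) Lx lin0.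
have Md := pos_diag_morphism cH phir phil ipP Mb MK MiK Mil Ms Mp.
pose r (a : R[i]) : R[i] := 4.-root a.
have r0 a : 0 < a -> 0 < r a by rewrite /r rootC_gt0.
have r4 a : r a ^+ 4 = a by rewrite /r rootCK.
have rM a b : 0 < a -> 0 < b -> r (a * b) = r a * r b.
  by move=> a0 _; rewrite /r rootCMl // ltW.
have r1 : r 1 = 1 by rewrite /r rootC1.
pose F := fcalc Md r.
pose Fi := fcalc Md (fun a => (r a)^-1).
have Fb : bialgebra_morphism F by apply: fcalc_bialgebra.
have Fl : lin F by case: Fb.
have Fil : lin Fi by exact: lin_fcalc.
have FK x : Fi (F x) = x.
  rewrite /F /Fi fcalc_comp // -[RHS](fcalc1 Ml Md).
  by apply: eq_fcalc => // a a0; rewrite mulVf // gt_eqF // r0.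
have FiK x : F (Fi x) = x.
  rewrite /F /Fi fcalc_comp // -[RHS](fcalc1 Ml Md).
  by apply: eq_fcalc => // a a0; rewrite mulfV // gt_eqF // r0.
(* Both involutions invert M, hence invert its functional calculus. *)
have inv_anti (c : H -> H) : circ_Hopf c -> (forall x, M (c x) = c (Mi x)) ->
    forall x, F (c x) = c (Fi x).
  move=> cc McE; apply: (eigen_ext Md) => [x y|x y|a v a0 va].
  - by rewrite (circD cc) linD.
  - by rewrite linD // (circD cc).
  (* An involution that inverts M sends eigenvalue a to the conjugate of a^-1, which is a^-1 because
     a is real. *)
  have Mv : M (c v) = a^-1 *: c v.
    rewrite McE -[in LHS](scale1r v) -(mulVf (lt0r_neq0 a0)) -scalerA -va.
    rewrite linZ // MK (circZ cc) geC0_conj // ltW //.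
    by rewrite invr_gt0.
  rewrite /F /Fi (fcalc_eigen Ml _ _ Mv) (fcalc_eigen Ml _ _ va) (circZ cc).
  rewrite /r rootCV ?ltW // geC0_conj // ltW // invr_gt0; exact: r0.
have Fc : forall x, F (circ x) = circ (Fi x).
  by apply: inv_anti => // x; rewrite /M /Mi /L /Li !cK.
have Fz : forall x, F (loz x) = loz (Fi x).
  by apply: inv_anti => // x; rewrite /M /Mi /L /Li.
have Fic x : Fi (circ x) = circ (F x).
  by rewrite -[circ (F x)]FK Fc FK.
have Fiz x : Fi (loz x) = loz (F x).
  by rewrite -[loz (F x)]FK Fz FK.
have F4 x : F (F (F (F x))) = M x.
  rewrite -(fcalc_id Ml Md) /F !fcalc_comp //; apply: eq_fcalc => // a _ /=.
  by transitivity (r a ^+ 4); [rewrite !exprS expr0 mulr1 !mulrA|exact: r4].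
have [_ F1 FM FC] := Fb.
have [P PE] := lrmorphism_of Fl F1 FM.
have PK : cancel P Fi by move=> x; rewrite PE FK.
have FiPK : cancel Fi P by move=> x; rewrite PE FiK.
exists P, Fi; split=> //.
- split; first by exists Fi.
    by rewrite PE.
  by move=> x; rewrite PE bialgebra_antipode.
- have dE x y : circ_dot circ x y = ip x y.
    by rewrite /circ_dot (normal_integralE cH phir phil ipP).
  split=> [x y|x x0]; rewrite !dE.
    rewrite -[LHS]/(ip (P x) y) -[RHS]/(ip x (P y)) PE.
    apply: fcalc_selfadjoint => // a a0.
    by rewrite geC0_conj // ltW // r0.
  rewrite -[X in _ < X]/(ip (P x) x) PE.
  (* A selfadjoint square root Q of F gives <F x, x> = <Q x, Q x>. *)
  pose q (a : R[i]) : R[i] := sqrtC (r a).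
  pose Q := fcalc Md q.
  have QQ y : Q (Q y) = F y.
    by rewrite /Q fcalc_comp //; apply: eq_fcalc => // a _; rewrite -expr2 sqrtCK.
  rewrite -QQ /Q (fcalc_selfadjoint Ml Md ipP Ms); last first.
    by move=> a a0; rewrite geC0_conj // ltW // sqrtC_gt0 r0.
  apply: ip_gt0 => //; apply: contraNneq x0 => Qx.
  have Ql : lin Q by exact: lin_fcalc.
  by rewrite -(FK x) -QQ [Q x]Qx !lin0.
- apply/funext => x /=; rewrite !PE -!Fc -!Fiz.
  (* The sides have become P^-2 L x and P^2 L^-1 x; applying P^2 to both leaves L x = M (L^-1 x). *)
  apply: (can_inj FK); apply: (can_inj FK); rewrite !FiK F4.
  by rewrite -[circ (loz x)]/(Li x) /M LiK.
move=> loz_cqg; apply/funext => x /=; rewrite PE -Fc.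
have [psi [psir psil psiP]] := cqg_integral loz_cqg.
(* By uniqueness the two involutions share their integral, so <u, L^-1 u> is the squared norm of u
   for ◊. *)
have Lip u : u != 0 -> 0 < ip u (Li u).
  move=> u0; have := ip_gt0 psiP u0; rewrite /form_of /pairing.
  by rewrite (integral_uniq psir phil) /ip /form_of /Li cK.
suff LE y : L y = F (F y) by rewrite -LE /L cK.
move: y; apply: (eigen_ext Md) => [u v|u v|a v a0 va].
- by rewrite linD.
- by rewrite !linD.
rewrite /F (fcalc_eigen Ml _ _ va) linZ ?(fcalc_eigen Ml _ _ va) //.
rewrite scalerA; apply/eqP; rewrite -subr_eq0.
(* Here w = L v - b v with b = r(a)^2, so b^2 = a. From L^2 v = a v one gets L w = - b w, and <L w,
   w> > 0 would contradict b > 0 unless w = 0. *)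
set w := (X in X == 0).
have Lw : L w = - (r a * r a) *: w.
  rewrite /w linB // linZ // -[L (L v)]/(M v) va -{1}(r4 a) scalerBr !scaleNr.
  by rewrite opprK scalerA !exprS expr0 mulr1 !mulrA addrC.
apply/negPn/negP => w0.
have Lw0 : L w != 0.
  by apply: contraNneq w0 => Lw0; rewrite -(LK w) Lw0 lin0.
have := Lip _ Lw0; rewrite LK Lw ipZl // nmulr_rgt0; last first.
  by rewrite oppr_lt0 mulr_gt0 // r0.
by rewrite le_gtF // ip_ge0.
Qed.
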